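(* Let $\mathcal{I}\subseteq\Phi^+(C_\ell)$ be an ideal. Let $s:=\min\{1\le i\le\ell: 2\epsilon_i\in\mathcal{I}\}$ if such $i$ exists and $s:=\ell+1$ otherwise, and let $n:=\min\big(\{1\le i\le\ell: E_i(\mathcal{I})\ne\emptyset\}\cup\{s\}\big)$. Then the toric arrangement $\mathscr{A}_{T_{\mathcal{I}}}$ with respect to the integer lattice is strictly supersolvable with exponents $$\exp(\mathscr{A}_{T_{\mathcal{I}}})=\{0^{n-1}\}\cup\{b_i\}_{i=n}^{s-1}\cup\{2(\ell-i+1)\}_{i=s}^{\ell}.$$
   Context: Let $\epsilon_1,\dots,\epsilon_\ell$ be the standard basis of $\mathbb{R}^\ell$. $\Phi^+(C_\ell)=\{2\epsilon_i\ (1\le i\le\ell),\ \epsilon_i\pm\epsilon_j\ (1\le i<j\le\ell)\}$ with base $\alpha_i=\epsilon_i-\epsilon_{i+1}$ ($1\le i<\ell$), $\alpha_\ell=2\epsilon_\ell$. Order $\Phi^+$ by $\beta_1\ge\beta_2$ iff $\beta_1-\beta_2$ is a nonnegative integer combination of the $\alpha_i$; an ideal is a downward-closed subset. $E_i(\mathcal{I}):=\{\epsilon_i\pm\epsilon_j\in\mathcal{I}: j>i\}$ and $b_i:=|E_i(\mathcal{I})|$. For $\beta=\sum_i c_i\epsilon_i\in\mathcal{I}$ let $H_\beta=\{t\in(\mathbb{S}^1)^\ell:t_1^{c_1}\cdots t_\ell^{c_\ell}=1\}$; $\mathscr{A}_{T_{\mathcal{I}}}$ is the set of connected components of the $H_\beta$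 (e.g. $2\epsilon_i$ contributes $\{t_i=1\}$ and $\{t_i=-1\}$). The poset of layers $L(\mathscr{A})$ consists of connected components of nonempty intersections of subsets of $\mathscr{A}$ (empty intersection $=(\mathbb{S}^1)^\ell$), ordered by reverse inclusion, rank $=$ codimension; $\chi_{\mathscr{A}}(t)=\sum_X\mu(T,X)t^{\dim X}$; if $\chi_{\mathscr{A}}(t)=t^{\ell-r}\prod_{i=1}^r(t-d_i)$ ($r$ the rank, $d_i$ positive integers), $\exp(\mathscr{A})=\{0^{\ell-r},d_1,\dots,d_r\}$ ($e^d$ = multiplicity $d$). $\mathscr{A}$ is strictly supersolvable if $L(\mathscr{A})$ is: for a poset $\mathcal{P}$ (finite, minimum $\hat0$, ranked, each $\mathcal{P}_{\le x}$ a geometric lattice), a TM-ideal is a pure (maximal elements of equal rank), join-closed ($T\subseteq\mathcal{Q}\Rightarrow$ all minimal upper bounds of $T$ lie in $\mathcal{Q}$) order ideal $\mathcal{Q}$ such that each atom $a\notin\mathcal{Q}$ and $y\in\mathcal{Q}$ have exactly one minimal upper bound, and for every maximal $x\in\mathcal{P}$ some maximal $y\in\mathcal{Q}$ is modular in the lattice $\mathcal{P}_{\le x}$ (i.e. $y\wedge(w\vee z)=(y\wedge w)\vee z$ for $z\le y$); $\mathcal{P}$ is strictly supersolvable if there is a chain $\{\hat0\}=\mathcal{Q}_0\subsetneq\cdots\subsetneq\mathcal{Q}_r=\mathcal{P}$ with $\mathcal{Q}_i$ a TM-ideal of $\mathcal{Q}_{i+1}$ and $\operatorname{rk}\mathcal{Q}_i=i$.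 *)

(* Defs.v *)
From HB Require Import structures.
From mathcomp Require Import all_boot all_order all_algebra.
From mathcomp Require Import all_classical all_reals all_analysis.
From mathcomp Require Import complex.
Import Order.TTheory GRing.Theory Num.Theory numFieldNormedType.Exports.

Set Implicit Arguments.
Unset Strict Implicit.
Unset Printing Implicit Defensive.

Local Open Scope ring_scope.
Local Open Scope classical_set_scope.

Section Posets.
Variable U : choiceType.
Implicit Types (P Q S T : set U) (le : U -> U -> Prop).

Definition ltP le x y := le x y /\ x <> y.

Definition covers P le x y :=
  [/\ P x, P y, ltP le x y & ~ (exists z, [/\ P z, ltP le x z & ltP le z y])].

Definition is_partial_order P le :=
  [/\ forall x, P x -> le x x,
      forall x y, P x -> P y -> le x y -> le y x -> x = y &
      forall x y z, P x -> P y -> P z -> le x y -> le y z -> le x z].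

Definition is_minimum P le b := P b /\ forall x, P x -> le b x.

Definition below P le x := [set y | P y /\ le y x].

Definition is_ub P le T z := P z /\ forall t, T t -> le t z.
Definition is_lub P le T z := is_ub P le T z /\ forall u, is_ub P le T u -> le z u.
Definition min_ub P le T z :=
  is_ub P le T z /\ forall u, is_ub P le T u -> le u z -> u = z.

Definition is_join P le a b j :=
  [/\ P j, le a j, le b j & forall u, P u -> le a u -> le b u -> le j u].
Definition is_meet P le a b m :=
  [/\ P m, le m a, le m b & forall u, P u -> le u a -> le u b -> le u m].

Definition is_lattice S le :=
  forall a b, S a -> S b -> (exists j, is_join S le a b j) /\ (exists m, is_meet S le a b m).

Definition is_atom P le bot a := covers P le bot a.

Definition is_geometric_lattice S le (rk : U -> nat) bot :=
  [/\ is_lattice S le,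
      (forall y, S y -> is_lub S le [set a | is_atom S le bot a /\ le a y] y) &
      (forall a b j m, S a -> S b -> is_join S le a b j -> is_meet S le a b m ->
          (rk j + rk m <= rk a + rk b)%N)].

Definition locally_geometric P le (rk : U -> nat) bot :=
  [/\ finite_set P, is_partial_order P le, is_minimum P le bot, rk bot = 0%N &
    [/\ (forall x y, covers P le x y -> rk y = (rk x).+1) &
      (forall x, P x -> is_geometric_lattice (below P le x) le rk bot)]].

Definition rank_is P (rk : U -> nat) r :=
  (exists x, P x /\ rk x = r) /\ forall x, P x -> (rk x <= r)%N.

Definition is_maximal P le x := P x /\ forall y, P y -> le x y -> y = x.

Definition is_order_ideal P le Q :=
  Q `<=` P /\ forall x y, Q y -> P x -> le x y -> Q x.

Definition is_pure le (rk : U -> nat) Q :=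
  forall x y, is_maximal Q le x -> is_maximal Q le y -> rk x = rk y.

Definition is_join_closed P le Q :=
  forall T, T `<=` Q -> forall z, min_ub P le T z -> Q z.

Definition is_modular_in S le y :=
  S y /\ forall w z, S w -> S z -> le z y ->
  forall j m m' j', is_join S le w z j -> is_meet S le y j m ->
    is_meet S le y w m' -> is_join S le m' z j' -> m = j'.

Definition is_TM_ideal P le (rk : U -> nat) bot Q :=
  [/\ is_order_ideal P le Q, is_pure le rk Q, is_join_closed P le Q,
      (forall a y, is_atom P le bot a -> ~ Q a -> Q y ->
         exists! z, min_ub P le [set a; y] z) &
      (forall x, is_maximal P le x ->
         exists y, is_maximal Q le y /\ is_modular_in (below P le x) le y)].

Definition strictly_supersolvable P le (rk : U -> nat) bot :=
  locally_geometric P le rk bot /\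
  exists (r : nat) (Qs : nat -> set U),
    [/\ rank_is P rk r, Qs 0%N = [set bot], Qs r = P &
        forall i, (i < r)%N ->
          [/\ Qs i `<=` Qs i.+1, Qs i <> Qs i.+1,
              is_TM_ideal (Qs i.+1) le rk bot (Qs i) & rank_is (Qs i) rk i]].

Definition is_moebius P le bot (mu : U -> int) :=
  mu bot = 1 /\
  forall x, P x -> x <> bot -> \sum_(z \in [set z | P z /\ le z x]) mu z = 0.

(* chi(t) = sum_X mu(bot, X) t^{dim X}, with dim X = d - rk X *)
Definition charpoly_from P (d : nat) (rk : U -> nat) (mu : U -> int) : {poly int} :=
  \sum_(X \in P) (mu X)%:P * 'X^(d - rk X).

End Posets.

(* A point t of (S^1)^l is an l x 2 real matrix whose i-th row (a, b)        *)
(* satisfies a^2 + b^2 = 1, representing t_i = a + i b.                      *)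
Notation ivec l := {ffun 'I_l -> int}.

Section Torus.
Variables (R : realType) (l : nat).

Definition Point := 'M[R]_(l, 2).

Definition torus : set Point :=
  [set t | forall i : 'I_l, t i ord0 ^+ 2 + t i ord_max ^+ 2 = 1].

Definition zcoord (t : Point) (i : 'I_l) : R[i] := (t i ord0 +i* t i ord_max)%C.


Definition character (c : ivec l) (t : Point) : R[i] :=
  \prod_(i < l) zcoord t i ^ (c i).

Definition hypertorus (c : ivec l) : set Point :=
  [set t | torus t /\ character c t = 1].

Definition components (S : set Point) : set (set Point) :=
  [set C | exists2 x, S x & C = connected_component S x].

Definition toric_arrangement (I : set (ivec l)) : set (set Point) :=
  [set C | exists2 b, I b & components (hypertorus b) C].

Definition layers (A : set (set Point)) : set (set Point) :=
  [set X | X !=set0 /\ exists2 F : set (set Point), F `<=` A &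
     components (torus `&` \bigcap_(Y in F) Y) X].

Definition layer_le (X Y : set Point) : Prop := Y `<=` X.

(* codimension of a layer: the rank of the lattice of characters that are *)
(* constant on X (the maximal number of Q-linearly independent such c).   *)
Definition char_constant_on (X : set Point) (c : ivec l) :=
  forall x y, X x -> X y -> character c x = character c y.

Definition codim_ge (X : set Point) (k : nat) :=
  exists M : 'M[int]_(k, l),
    \rank (map_mx (fun z : int => z%:~R : rat) M) = k /\
    forall r : 'I_k, char_constant_on X [ffun j => M r j].

Definition codim (X : set Point) : nat :=
  \max_(k < l.+1 | `[< codim_ge X k >]) k.

Definition has_exponents (A : set (set Point)) (E : seq nat) :=
  exists (r : nat) (ds : seq nat),
    [/\ rank_is (layers A) codim r,
        size ds = r, all (fun d => 0 < d)%N ds &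
      [/\
        (forall mu, is_moebius (layers A) layer_le torus mu ->
           charpoly_from (layers A) l codim mu =
           'X^(l - r) * \prod_(d <- ds) ('X - (d%:Z)%:P)) &
        perm_eq (nseq (l - r) 0%N ++ ds) E]].

Definition arrangement_strictly_supersolvable (A : set (set Point)) :=
  strictly_supersolvable (layers A) layer_le codim torus.

End Torus.

(* Part 3. The root system C_l (indices 1..l as natural numbers).           *)
Section RootSystem.
Variable l : nat.

Definition eps (i : nat) : ivec l := [ffun j : 'I_l => ((j.+1 == i) : nat)%:Z].

Definition alpha (k : nat) : ivec l :=
  if (k < l)%N then eps k - eps k.+1 else eps k *+ 2.

Definition pos_roots : set (ivec l) :=
  [set b | (exists i, [/\ (1 <= i)%N, (i <= l)%N & b = eps i *+ 2]) \/
           (exists i j, [/\ (1 <= i)%N, (i < j)%N, (j <= l)%N &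
                            (b = eps i - eps j \/ b = eps i + eps j)])].

Definition root_ge (b1 b2 : ivec l) :=
  exists k : nat -> nat,
    b1 - b2 = \sum_(1 <= m < l.+1) alpha m *+ k m.

Definition is_ideal (I : set (ivec l)) :=
  I `<=` pos_roots /\
  forall b1 b2, I b1 -> pos_roots b2 -> root_ge b1 b2 -> I b2.

Definition Eset (I : set (ivec l)) (i : nat) : set (ivec l) :=
  [set b | I b /\ exists j, [/\ (i < j)%N, (j <= l)%N &
                                 (b = eps i - eps j \/ b = eps i + eps j)]].

(* b_i = |E_i(I)|, the number of roots eps_i -+ eps_j (j > i) in I *)
Definition bcount (I : set (ivec l)) (i : nat) : nat :=
  \sum_(i.+1 <= j < l.+1) ((`[< I (eps i - eps j)%R >] : nat) + (`[< I (eps i + eps j)%R >] : nat))%N.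

Definition s_index (I : set (ivec l)) : nat :=
  (find (fun k => `[< I (eps k.+1 *+ 2) >]) (iota 0 l)).+1.

Definition n_index (I : set (ivec l)) : nat :=
  minn (s_index I) (find (fun k => `[< Eset I k.+1 !=set0 >]) (iota 0 l)).+1.

Definition expected_exponents (I : set (ivec l)) : seq nat :=
  let s := s_index I in let n := n_index I in
  nseq n.-1 0%N ++ [seq bcount I i | i <- iota n (s - n)]
               ++ [seq (2 * (l - i + 1))%N | i <- iota s (l.+1 - s)].

End RootSystem.

(* Main.v *)
(* Idea.  Locally at a point z of the torus, the layers through z are the sets
   z * exp(i V), where V is the orthogonal of a set S of characters in I that
   take the value 1 at z.  Inclusion of layers is inclusion of spans, so the
   layers containing a given one form the lattice of flats of a vector
   configuration, with codimension as rank function.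

   For type C, let I_k be the set of roots in I supported on the coordinates of
   (0-based) index at least k.  A root in I_k but not in I_{k+1} expresses t_k as
   a function of the later coordinates, up to finitely many choices (t_k = 1 or
   t_k = -1 for 2 eps_k), and for an ideal two such functions can only agree on
   a hypertorus of I_{k+1}.  Hence the layers P of I_k fiber over the layers Q of
   I_{k+1}: besides Q, P consists of the intersections of a layer of Q with one of
   the d_k graphs.  This makes Q a TM-ideal of P, and the Moebius function
   satisfies mu(X) = - #{graphs containing X} * mu(pi X) for X outside Q, pi X
   being the smallest layer of Q containing X; summing gives
   t chi_P(t) = (t - d_k) chi_Q(t). *)
Require Import Defs.
From HB Require Import structures.
From mathcomp Require Import all_boot all_order all_algebra.
From mathcomp Require Import all_classical all_reals all_analysis.
From mathcomp Require Import complex ring lra zify.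

Import Order.TTheory GRing.Theory Num.Theory numFieldNormedType.Exports.

Set Implicit Arguments.
Unset Strict Implicit.
Unset Printing Implicit Defensive.

Local Open Scope ring_scope.
Local Open Scope classical_set_scope.



(** * Points of the torus and characters *)

(** Two features of the roots make the fibration work. Every root e in I_k outside I_{k+1} is a
    multiple m f of a character f with coefficient 1 at coordinate k (m is 2 for 2 eps_i and 1
    otherwise). Rotating that coordinate alone gives f any prescribed value and does not disturb
    I_{k+1}; hence a graph meets every layer of Q, and in a connected set. Moreover two such roots
    have an integer combination in I_{k+1} with a nonzero coefficient on the second. Inside one
    graph the others therefore impose only conditions from I_{k+1}, and a layer outside Q is
    recovered from its projection and any one graph containing it. This is where the ideal property
    enters the fibration. Layers are defined topologically, as components, while spans are linear
    data. The bridge is that points of a common level set of S close to z differ from z by a small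
    angle orthogonal to S. When d_k = 0 the layers do not change; such coordinates account for the
    exponents 0. *)

Section Cis.
Variable R : realType.
Implicit Types x y : R.

Definition cis x : R[i] := (cos x +i* sin x)%C.

Lemma cisD x y : cis (x + y) = cis x * cis y.
Proof. by rewrite /cis cosD sinD addrC [RHS]/GRing.mul /= [sin x * _ + _]addrC; congr Complex; rewrite addrC. Qed.

Lemma cis0 : cis 0 = 1.
Proof. by rewrite /cis cos0 sin0. Qed.

Lemma cis_neq0 x : cis x != 0.
Proof.
apply/eqP => x0; have := cis0.
by rewrite -(subrr x) cisD x0 mul0r => /esym/eqP; rewrite oner_eq0.
Qed.

Lemma cisN x : cis (- x) = (cis x)^-1.
Proof.
by apply: (mulfI (cis_neq0 x)); rewrite -cisD subrr cis0 divff ?cis_neq0.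
Qed.

Lemma cisMz x (n : int) : cis (n%:~R * x) = cis x ^ n.
Proof.
have natE (m : nat) : cis (m%:R * x) = cis x ^+ m.
  elim: m => [|m IHm]; first by rewrite mul0r cis0.
  by rewrite -natr1 mulrDl mul1r cisD IHm exprSr.
case: n => n; first exact: natE.
by rewrite NegzE mulrNz mulNr cisN natE.
Qed.

Lemma cis_sum (J : finType) (F : J -> R) : cis (\sum_j F j) = \prod_j cis (F j).
Proof. by apply: (big_morph cis) => [x y|]; [exact: cisD | exact: cis0]. Qed.

Lemma cis_surj x y : x ^+ 2 + y ^+ 2 = 1 -> exists a, cis a = (x +i* y)%C.
Proof.
move=> xy1.
have x1 : -1 <= x <= 1 by have := sqr_ge0 y; rewrite !expr2 in xy1 *; nra.
have cosx : cos (acos x) = x by rewrite acosK ?in_itv.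
have sinx : sin (acos x) = `|y|.
  by rewrite sin_acos // -xy1 [_ + y ^+ 2]addrC addrK sqrtr_sqr.
have [y0|y0] := leP 0 y.
  by exists (acos x); rewrite /cis cosx sinx ger0_norm.
by exists (- acos x); rewrite /cis cosN sinN cosx sinx ltr0_norm // opprK.
Qed.

(** Half-angle formula: [cos x = 1] forces the sine of [|x| / 2] to vanish, while [|x| / 2] lies
    strictly between 0 and pi when x is nonzero. *)
Lemma cis_eq1_small x : cis x = 1 -> `|x| < pi *+ 2 -> x = 0.
Proof.
move=> [cosx _] x_lt; apply/eqP; rewrite -normr_eq0; apply/negPn/negP => x_neq0.
have h_gt0 : 0 < `|x| / 2 < pi.
  have : 0 < `|x| by rewrite lt_def x_neq0 normr_ge0.
  by lra.
have := sin_gt0_pi h_gt0; rewrite lt_def => /andP[/eqP sin_neq0 _]; apply: sin_neq0.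
have : cos ((`|x| / 2) *+ 2) = 1 by rewrite -mulr_natr divfK ?pnatr_eq0 // cos_norm.
rewrite cos_mulr2n cos2sin2 => s1; apply/eqP; rewrite -sqrf_eq0; apply/eqP; lra.
Qed.

Lemma cis_2pi (k : int) : cis (k%:~R * (pi *+ 2)) = 1.
Proof.
by rewrite cisMz /cis cos2pi sin2pi exp1rz.
Qed.

Lemma cis_eq1 x : cis x = 1 -> exists k : int, x = k%:~R * (pi *+ 2).
Proof.
move=> x1; have p_gt0 : 0 < pi *+ 2 :> R by rewrite pmulrn_lgt0 ?pi_gt0.
pose k := Num.floor (x / (pi *+ 2)); exists k.
apply/eqP; rewrite -subr_eq0; apply/eqP/cis_eq1_small.
  by rewrite cisD cisN cis_2pi x1 invr1 mulr1.
have k_le : k%:~R * (pi *+ 2) <= x by rewrite -ler_pdivlMr // floor_le.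
have k_gt : x < (k + 1)%:~R * (pi *+ 2) by rewrite -ltr_pdivrMr // floorD1_gt.
rewrite intrD mulrDl mul1r in k_gt.
rewrite ger0_norm ?subr_ge0 //; lra.
Qed.

Lemma cis_line_eq1 x : (forall s, cis (s * x) = 1) -> x = 0.
Proof.
move=> x1; apply/eqP/negPn/negP => x_neq0.
(* At the parameter [pi / x] the value would be [cis pi], that is -1. *)
have := x1 (pi / x); rewrite divfK // => -[]; rewrite cospi => /eqP.
by rewrite -subr_eq0 -opprD oppr_eq0 -[1 + 1]/(2%:R) pnatr_eq0.
Qed.

End Cis.

Lemma ffunMzE (l : nat) (b : ivec l) (n : int) i : (b *~ n) i = b i * n.
Proof.
rewrite -mulrzz; case: n => n; first by rewrite -!pmulrn ffunMnE.
by rewrite NegzE !mulrNz -!pmulrn ffunE ffunMnE.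
Qed.

Section Rotation.
Variables (R : realType) (l : nat).
Implicit Types (z t : Point R l) (th : 'cV[R]_l) (b : ivec l).

Lemma zcoord_inj z t : (forall i, zcoord z i = zcoord t i) -> z = t.
Proof.
move=> zt; apply/matrixP => i k; have [z0 z1] := zt i.
have [->|->//] : k = ord0 \/ k = ord_max; last by [].
by case: k => [[|[|//]] ?]; [left|right]; apply: val_inj.
Qed.

(* The product of z with exp(i th). *)
Definition rot z th : Point R l :=
  \matrix_(i, k) let w := zcoord z i * cis (th i ord0) in
                 if k == ord0 then complex.Re w else complex.Im w.

Lemma zcoord_rot z th i : zcoord (rot z th) i = zcoord z i * cis (th i ord0).
Proof. by rewrite {1}/zcoord !mxE; case: (_ * _). Qed.

Lemma rotD z th ph : rot (rot z th) ph = rot z (th + ph).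
Proof.
by apply: zcoord_inj => i; rewrite !zcoord_rot mxE cisD mulrA.
Qed.

Lemma rot0 z : rot z 0 = z.
Proof. by apply: zcoord_inj => i; rewrite zcoord_rot mxE cis0 mulr1. Qed.

Lemma rotK z th : rot (rot z th) (- th) = z.
Proof. by rewrite rotD subrr rot0. Qed.

Lemma torus_neq0 z i : torus z -> zcoord z i != 0.
Proof.
move=> /(_ i) zi; apply/negP => /eqP[z0 z1].
by move: zi; rewrite z0 z1 !expr0n addr0 => /esym/eqP; rewrite oner_eq0.
Qed.

Lemma torus_cis z : torus z -> exists th, forall i, zcoord z i = cis (th i ord0).
Proof.
move=> zT; have /choice[f fE] i : exists a, cis a = zcoord z i by exact: cis_surj.
by exists (\col_i f i) => i; rewrite mxE fE.
Qed.

Lemma torus_rot z th : torus z -> torus (rot z th).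
Proof.
move=> zT i; rewrite !mxE /=.
transitivity ((z i ord0 ^+ 2 + z i ord_max ^+ 2) * (cos (th i ord0) ^+ 2 + sin (th i ord0) ^+ 2)).
  by rewrite -[(z i ord0 * sin _) + _]addrC !expr2; ring.
by rewrite zT cos2Dsin2 mulr1.
Qed.

Lemma rot_surj z t : torus z -> torus t -> exists th, t = rot z th.
Proof.
move=> zT tT; have [th thE] := torus_cis zT; have [ph phE] := torus_cis tT.
exists (ph - th); apply: zcoord_inj => i.
by rewrite zcoord_rot !mxE thE phE -cisD addrCA subrr addr0.
Qed.

Definition tunit : Point R l := \matrix_(i, k) (k == ord0)%:R.

Lemma torus_tunit : torus tunit.
Proof. by move=> i; rewrite !mxE /= expr1n expr0n addr0. Qed.

Definition dot b th : R := \sum_i (b i)%:~R * th i ord0.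

Lemma dotDl b c th : dot (b + c) th = dot b th + dot c th.
Proof. by rewrite -big_split; apply: eq_bigr => i _; rewrite ffunE intrD mulrDl. Qed.

Lemma dotMzl b n th : dot (b *~ n) th = n%:~R * dot b th.
Proof.
rewrite mulr_sumr; apply: eq_bigr => i _.
by rewrite ffunMzE intrM mulrA [n%:~R * _]mulrC.
Qed.

Lemma dotMn b n th : dot (b *+ n) th = n%:R * dot b th.
Proof. by rewrite pmulrn dotMzl. Qed.

Lemma dotMn_eq0 b n th : (0 < n)%N -> dot (b *+ n) th = 0 -> dot b th = 0.
Proof.
move=> n0 /eqP; rewrite dotMn mulf_eq0 pnatr_eq0 => /orP[/eqP n_eq0|/eqP //].
by rewrite n_eq0 in n0.
Qed.

Lemma dotDr b th ph : dot b (th + ph) = dot b th + dot b ph.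
Proof. by rewrite -big_split; apply: eq_bigr => i _; rewrite mxE mulrDr. Qed.

Lemma dotZr b a th : dot b (a *: th) = a * dot b th.
Proof. by rewrite mulr_sumr; apply: eq_bigr => i _; rewrite mxE mulrCA. Qed.

Lemma dotNr b th : dot b (- th) = - dot b th.
Proof. by rewrite -scaleN1r dotZr mulN1r. Qed.

Lemma dot_delta b i : dot b (delta_mx i ord0) = (b i)%:~R.
Proof.
rewrite /dot (bigD1 i) //= big1 => [|j /negPf ji]; rewrite mxE ?ji ?andbF ?eqxx ?mulr1 ?addr0 //=.
by rewrite mulr0.
Qed.

Lemma character_rot b z th : torus z ->
  character b (rot z th) = character b z * cis (dot b th).
Proof.
move=> zT; rewrite /dot cis_sum -big_split; apply: eq_bigr => i _.
by rewrite zcoord_rot exprzMl ?unitfE ?torus_neq0 ?cis_neq0 // cisMz.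
Qed.

Lemma character_neq0 b z : torus z -> character b z != 0.
Proof.
move=> zT; apply/prodf_neq0 => i _.
by apply: expfz_neq0; exact: torus_neq0.
Qed.

Lemma character_rot_eq b z th : torus z ->
  character b (rot z th) = character b z <-> cis (dot b th) = 1.
Proof.
move=> zT; rewrite character_rot //; split=> [|->]; last by rewrite mulr1.
by rewrite -{2}[character b z]mulr1; apply/mulfI/character_neq0.
Qed.

Lemma character_tunit b : character b tunit = 1.
Proof.
rewrite /character big1 // => i _.
by rewrite /zcoord !mxE /= -[(1 +i* 0)%C]/(1 : R[i]) exp1rz.
Qed.

Lemma character_torus z : torus z -> exists th, forall b, character b z = cis (dot b th).
Proof.
move=> zT; have [th ->] := rot_surj torus_tunit zT; exists th => b.
by rewrite (character_rot b th torus_tunit) character_tunit mul1r.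
Qed.

Lemma dot_retract b th i : b i = 1 ->
  dot b (th - dot b th *: delta_mx i ord0) = 0.
Proof. by move=> bi; rewrite dotDr dotNr dotZr dot_delta bi mulr1 subrr. Qed.

(** The correction is a multiple of 2 pi in a single coordinate. An angle can thus be made
    orthogonal to a character without moving the point it leads to. *)
Lemma rot_retract b z th i : cis (dot b th) = 1 ->
  rot z (th - dot b th *: delta_mx i ord0) = rot z th.
Proof.
move=> /cis_eq1[k kE]; rewrite -rotD; apply: zcoord_inj => j.
rewrite [LHS]zcoord_rot !mxE kE.
have [_|_] := eqVneq j i; last by rewrite mulr0 oppr0 cis0 mulr1.
by rewrite mulr1 -mulNr -intrN cis_2pi mulr1.
Qed.

Lemma near_rot (z : 'M[R]_(l, 2)) (e : R) : torus z -> 0 < e ->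
  \forall t \near z, torus t -> exists2 th, t = rot z th &
    forall i, `|th i ord0| < e.
Proof.
move=> zT e0.
(* [re] and [im] are the real and imaginary parts of t_i times the conjugate of z_i, which tends to
   1. Where the real part is positive, the angle is the arcsine of the imaginary part. *)
pose re i (t : 'M[R]_(l, 2)) := z i ord0 * t i ord0 + z i ord_max * t i ord_max.
pose im i (t : 'M[R]_(l, 2)) := z i ord0 * t i ord_max - z i ord_max * t i ord0.
have co i k : {for z, continuous (fun t : 'M[R]_(l, 2) => t i k)} by exact: coord_continuous.
have re_co i : re i t @[t --> z] --> (1 : R).
  have -> : 1 = re i z by rewrite /re -!expr2 zT.
  exact: (cvgD (cvgM (cvg_cst _) (co _ _)) (cvgM (cvg_cst _) (co _ _))).
have im_co i : im i t @[t --> z] --> (0 : R).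
  have -> : 0 = im i z by rewrite /im mulrC subrr.
  exact: (cvgB (cvgM (cvg_cst _) (co _ _)) (cvgM (cvg_cst _) (co _ _))).
have asin0 : asin 0 = 0 :> R.
  by rewrite -{1}sin0 sinK // in_itv /=; have := pi_ge0 R; move=> ?; apply/andP; split; lra.
have as_co i : asin (im i t) @[t --> z] --> (0 : R).
  rewrite -asin0; apply: (continuous_cvg _ _ (im_co i)).
  by apply: continuous_asin; rewrite ltrN10 ltr01.
have FF : Filter (nbhs z) by exact: nbhs_filter.
have reN : \forall t \near z, forall i, 0 < re i t.
  apply: (filter_forall (f := fun i t => 0 < re i t) FF) => i; apply: (cvgr_gt 1); [exact: re_co | exact: ltr01].
have asN : \forall t \near z, forall i, `|asin (im i t)| < e.
  apply: (filter_forall (f := fun i t => `|asin (im i t)| < e) FF) => i; have /cvgr0_norm_lt := as_co i; exact.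
apply: (filterS2 _ _ reN asN) => t reP asP tT; exists (\col_i asin (im i t)).
  apply: zcoord_inj => i; rewrite zcoord_rot mxE.
  have r0 := reP i.
  have sq1 : re i t ^+ 2 + im i t ^+ 2 = 1.
    transitivity ((z i ord0 ^+ 2 + z i ord_max ^+ 2) * (t i ord0 ^+ 2 + t i ord_max ^+ 2)).
      by rewrite /re /im !expr2; ring.
    by rewrite zT tT mulr1.
  have im1 : -1 <= im i t <= 1 by have := sqr_ge0 (re i t); rewrite !expr2 in sq1 *; nra.
  have -> : cis (asin (im i t)) = (re i t +i* im i t)%C.
    rewrite /cis cos_asin // asinK ?in_itv // -sq1 addrK sqrtr_sqr gtr0_norm //.
  have z1 := zT i; rewrite !expr2 in z1.
  rewrite /zcoord /re /im; apply/eqP; rewrite eq_complex /=; apply/andP; split; apply/eqP.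
    transitivity ((z i ord0 * z i ord0 + z i ord_max * z i ord_max) * t i ord0); last by ring.
    by rewrite z1 mul1r.
  transitivity ((z i ord0 * z i ord0 + z i ord_max * z i ord_max) * t i ord_max); last by ring.
  by rewrite z1 mul1r.
by move=> i; rewrite mxE.
Qed.

Lemma rot_continuous z th :
  continuous (fun s : R => rot z (s *: th) : 'M[R]_(l, 2)).
Proof.
move=> s A [P nP PA]; rewrite /nbhs /=.
have FF : Filter (nbhs s) by exact: nbhs_filter.
have nearP : \forall x \near s, forall i k, P i k (rot z (x *: th) i k).
  apply: (filter_forall (f := fun i x => forall k, P i k (rot z (x *: th) i k)) FF) => i.
  apply: (filter_forall (f := fun k x => P i k (rot z (x *: th) i k)) FF) => k.
  suff /(_ _ (nP i k)) : rot z (x *: th) i k @[x --> s] --> rot z (s *: th) i k by [].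
  have mulco : x * th i ord0 @[x --> s] --> s * th i ord0.
    by apply: cvgM; [exact: cvg_id | exact: cvg_cst].
  have cco : cos (x * th i ord0) @[x --> s] --> cos (s * th i ord0).
    by apply: (continuous_cvg _ _ mulco); exact: continuous_cos.
  have sco : sin (x * th i ord0) @[x --> s] --> sin (s * th i ord0).
    by apply: (continuous_cvg _ _ mulco); exact: continuous_sin.
  rewrite !mxE /=; under eq_fun do rewrite !mxE.
  case: (k == ord0) => /=.
    exact: (cvgB (cvgM (cvg_cst _) cco) (cvgM (cvg_cst _) sco)).
  exact: (cvgD (cvgM (cvg_cst _) sco) (cvgM (cvg_cst _) cco)).
by apply: filterS nearP => x xP; apply: PA => i k.
Qed.

End Rotation.

(** * Rational spans of characters *)

Section Closure.
Variables (R : realType) (l : nat).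
Implicit Types (S T U : set (ivec l)) (b c e : ivec l) (th : 'cV[R]_l).

Definition orth S th := forall b, S b -> dot b th = 0.

(* The double orthogonal: the integer vectors in the rational span of S. *)
Definition cl S : set (ivec l) := [set c | forall th, orth S th -> dot c th = 0].

Lemma sub_cl S : S `<=` cl S.
Proof. by move=> b Sb th; apply. Qed.

Lemma orth_sub S T th : S `<=` cl T -> orth T th -> orth S th.
Proof. by move=> ST oT b /ST; apply. Qed.

Lemma cl_sub S T : S `<=` cl T -> cl S `<=` cl T.
Proof. by move=> ST c Sc th /(orth_sub ST); apply: Sc. Qed.

Lemma sub_cl_trans S T : S `<=` T -> S `<=` cl T.
Proof. by move=> ST; apply: (subset_trans ST); exact: sub_cl. Qed.

(** Shaped like [codim_ge], with [cl S] in place of the characters constant on a layer, so that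
    codimensions become ranks as soon as these two sets agree. *)
Definition rk_ge S k :=
  exists M : 'M[int]_(k, l),
    \rank (map_mx (fun z : int => z%:~R : rat) M) = k /\
    forall r : 'I_k, cl S [ffun j => M r j].

Definition rk S : nat := \max_(k < l.+1 | `[< rk_ge S k >]) k.

Definition realrow b : 'rV[R]_l := \row_j (b j)%:~R.

Lemma realrow_mul b th : realrow b *m th = (dot b th)%:M.
Proof.
apply/rowP => i; rewrite !mxE !ord1 eqxx mulr1n.
by apply: eq_bigr => j _; rewrite mxE.
Qed.

Lemma dot_eq0 b th : dot b th = 0 <-> realrow b *m th = 0.
Proof.
rewrite realrow_mul; split=> [->|]; first by rewrite raddf0.
by move=> /matrixP/(_ ord0 ord0); rewrite !mxE eqxx mulr1n.
Qed.

(** The columns of [cokermx W] are killed by W, so c pairs to zero with each of them. *)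
Lemma realrow_sub m (W : 'M[R]_(m, l)) c :
  (forall th, W *m th = 0 -> dot c th = 0) -> (realrow c <= W)%MS.
Proof.
move=> Wc; rewrite submxE; apply/eqP/matrixP => i j.
have := Wc (col j (cokermx W)).
rewrite colE mulmxA mulmx_coker mul0mx => /(_ erefl)/dot_eq0.
by rewrite mulmxA -colE => /matrixP/(_ i ord0); rewrite !mxE.
Qed.

Lemma row_intmx k (M : 'M[int]_(k, l)) r :
  row r (map_mx (fun z : int => z%:~R : R) M) = realrow [ffun j => M r j].
Proof. by apply/rowP => j; rewrite !mxE ffunE. Qed.

(** Codimension is defined by ranks over the rationals, orthogonality uses real angles; extending
    the field preserves the rank. *)
Lemma rank_intmx k (M : 'M[int]_(k, l)) :
  \rank (map_mx (fun z : int => z%:~R : rat) M) =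
  \rank (map_mx (fun z : int => z%:~R : R) M).
Proof.
rewrite -(mxrank_map (@ratr R)) -map_mx_comp; congr mxrank.
by apply/matrixP => i j; rewrite !mxE /= ratr_int.
Qed.

(** S may be infinite, but independent families in it have at most l members. One of maximal size
    spans S, since an element outside its span could be added to it. *)
Lemma basis_exists S : exists k (M : 'M[int]_(k, l)),
  [/\ \rank (map_mx (fun z : int => z%:~R : R) M) = k,
      forall r, S [ffun j => M r j] &
      forall b, S b -> (realrow b <= map_mx (fun z : int => z%:~R : R) M)%MS].
Proof.
pose P k := `[< exists M : 'M[int]_(k, l),
  \rank (map_mx (fun z : int => z%:~R : R) M) = k /\
  forall r, S [ffun j => M r j] >].
have P0 : exists k, P k.
  exists 0%N; apply/asboolP; exists 0; split; last by case.
  by apply/eqP; rewrite -leqn0 rank_leq_row.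
have Pl k : P k -> (k <= l)%N by by move=> /asboolP[M [Mk _]]; rewrite -Mk rank_leq_col.
case: (ex_maxnP P0 Pl) => k /asboolP[M [Mk MS]] kmax; exists k, M; split=> // b Sb.
apply/negPn/negP => bM.
pose M' : 'M[int]_(1 + k, l) := col_mx (\row_j b j) M.
suff /kmax : P (1 + k)%N by rewrite ltnn.
apply/asboolP; exists M'; split; last first.
  move=> r; rewrite (_ : [ffun j => _] = if fintype.split r is inr r' then [ffun j => M r' j] else b).
    by case: (fintype.split r).
  apply/ffunP => j; rewrite ffunE mxE; case: (fintype.split r) => ?; rewrite ?mxE // ffunE //.
apply/eqP; rewrite eqn_leq rank_leq_row /= map_col_mx.
apply: (@leq_ltn_trans (\rank (map_mx (fun z : int => z%:~R : R) M))); first by rewrite Mk.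
have /mxrank_leqif_sup [leM eqM] : (map_mx (fun z : int => z%:~R : R) M <=
    col_mx (map_mx (fun z : int => z%:~R : R) (\row_j b j)) (map_mx (fun z : int => z%:~R : R) M))%MS.
  by rewrite -addsmxE addsmxSr.
rewrite ltn_neqAle leM andbT eqM -addsmxE addsmx_sub.
apply: contra bM => /andP[+ _]; congr (_ <= _)%MS.
by apply/rowP => j; rewrite !mxE.
Qed.

(** Translates [cl] and [rk] to row spaces, where rank comparison and the dimension formula are
    available. *)
Lemma span_exists S : exists W : 'M[R]_l,
  [/\ forall c, (realrow c <= W)%MS <-> cl S c,
      rk S = \rank W &
      forall W' : 'M[R]_l, (forall b, S b -> (realrow b <= W')%MS) -> (W <= W')%MS].
Proof.
have [k [M [Mk MS SM]]] := basis_exists S.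
set MR := map_mx _ M in Mk SM.
have clE c : (realrow c <= <<MR>>)%MS <-> cl S c.
  rewrite genmxE; split.
    move=> /submxP[u cE] th oth; apply/dot_eq0; rewrite cE -mulmxA.
    suff -> : MR *m th = 0 by rewrite mulmx0.
    apply/row_matrixP => r; rewrite row_mul row_intmx row0; apply/dot_eq0; exact/oth/MS.
  move=> clc; apply: realrow_sub => th Mth; apply: clc => b /SM/submxP[u bE].
  by apply/dot_eq0; rewrite bE -mulmxA Mth mulmx0.
exists <<MR>>%MS; split=> //; last first.
  move=> W' SW'; rewrite genmxE; apply/row_subP => r; rewrite row_intmx; exact/SW'/MS.
rewrite mxrank_gen Mk; apply/eqP; rewrite eqn_leq; apply/andP; split.
  apply/bigmax_leqP => k' /asboolP[M' [Mk' clM']].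
  rewrite -Mk' rank_intmx -Mk -(mxrank_gen MR); apply: mxrankS.
  by apply/row_subP => r; rewrite row_intmx; apply/clE.
have kl : (k < l.+1)%N by rewrite ltnS -Mk rank_leq_col.
apply: (@leq_bigmax_cond _ _ (fun k : 'I_l.+1 => k : nat) (Ordinal kl)).
apply/asboolP; exists M; split=> [|r]; first by rewrite rank_intmx.
exact/sub_cl/MS.
Qed.

Lemma rk_eq S T : S `<=` cl T -> (rk T <= rk S)%N -> T `<=` cl S.
Proof.
have [W [Wcl -> Wmin]] := span_exists S; have [W' [W'cl -> _]] := span_exists T.
move=> ST rkTS b Tb; have WW' : (W <= W')%MS by apply: Wmin => c /ST/W'cl.
apply/Wcl; apply: (submx_trans (B := W')); first exact/W'cl/sub_cl.
by have [_ <-] := mxrank_leqif_sup WW'; rewrite eqn_leq rkTS mxrankS.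
Qed.

(** Dimension formula for the sum and the intersection of two spans; U lies in the intersection. *)
Lemma rk_submod S T U : U `<=` cl S -> U `<=` cl T ->
  (rk (S `|` T) + rk U <= rk S + rk T)%N.
Proof.
have [WS [WScl -> _]] := span_exists S; have [WT [WTcl -> _]] := span_exists T.
have [WU [_ -> WUmin]] := span_exists U; have [W [_ -> Wmin]] := span_exists (S `|` T).
move=> US UT; rewrite -(mxrank_sum_cap WS WT); apply: leq_add; apply: mxrankS.
  apply: Wmin => b [/sub_cl/WScl|/sub_cl/WTcl] bW; apply: (submx_trans bW).
    exact: addsmxSl.
  exact: addsmxSr.
by apply: WUmin => b Ub; rewrite sub_capmx; apply/andP; split; [apply/WScl/US|apply/WTcl/UT].
Qed.

Lemma rk0 : rk set0 = 0%N.
Proof.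
have [W [_ -> Wmin]] := span_exists set0.
by apply/eqP; rewrite mxrank_eq0 -submx0; apply: Wmin.
Qed.

Lemma rk1_le e : (rk [set e] <= 1)%N.
Proof.
have [W [_ -> Wmin]] := span_exists [set e].
apply: leq_trans (rank_leq_row (realrow e)).
by rewrite -(mxrank_gen (realrow e)); apply: mxrankS; apply: Wmin => b ->; rewrite genmxE.
Qed.

Lemma rkU1 S e : ~ cl S e -> rk (S `|` [set e]) = (rk S).+1.
Proof.
move=> Se; apply/eqP; rewrite eqn_leq; apply/andP; split.
  have := @rk_submod S [set e] set0; rewrite rk0 addn0 => /(_ (fun _ => False_ind _) (fun _ => False_ind _)) /leq_trans; apply.
  by rewrite -addn1 leq_add2l rk1_le.
rewrite ltnNge; apply/negP => rkS; apply: Se.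
apply: (@rk_eq _ (S `|` [set e])) => //; last by right.
by apply: sub_cl_trans => b; left.
Qed.

(** K is one more than the sum of the absolute values of the entries of a basis of S. Angles below
    [a / K] pair with each basis vector to less than a, hence to less than 2 pi, and a multiple of 2
    pi that small is zero. *)
Lemma finite_orth S : exists2 K : nat, (0 < K)%N &
  forall (a : R) th, (forall i, `|th i ord0| < a / K%:R) ->
  (forall b, S b -> cis (dot b th) = 1) -> a <= pi *+ 2 -> orth S th.
Proof.
have [k [M [_ MS SM]]] := basis_exists S.
pose K : nat := (\sum_r \sum_j absz (M r j)).+1.
exists K => // a th th_lt thS a_le b /SM/submxP[u bE].
apply/dot_eq0; rewrite bE -mulmxA (_ : _ *m th = 0) ?mulmx0 //.
apply/row_matrixP => r; rewrite row_mul row_intmx row0; apply/dot_eq0.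
apply: cis_eq1_small; first exact/thS/MS.
have K0 : 0 < K%:R :> R by rewrite ltr0n.
(* Without coordinates nothing forces a to be positive, but then every pairing is an empty sum. *)
have [l0|l0] := posnP l.
  have p_gt0 : 0 < pi *+ 2 :> R by rewrite pmulrn_lgt0 ?pi_gt0.
  rewrite /dot big1 ?normr0 // => i _.
  by have := ltn_ord i; rewrite {2}l0.
have a0 : 0 < a.
  by have := th_lt (Ordinal l0); rewrite ltr_pdivlMr //; apply: le_lt_trans; rewrite mulr_ge0 // ltW.
apply: (le_lt_trans (ler_norm_sum _ _ _)).
apply: (@le_lt_trans _ _ ((\sum_j absz (M r j))%N%:R * (a / K%:R))).
  rewrite natr_sum mulr_suml; apply: ler_sum => j _; rewrite ffunE normrM.
  by rewrite ler_pM // ?(ltW (th_lt j)) // -intr_norm -abszE -pmulrn.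
apply: (@lt_le_trans _ _ (K%:R * (a / K%:R))).
  by rewrite ltr_pM2r ?divr_gt0 // ltr_nat ltnS (bigD1 r) //= leq_addr.
by rewrite mulrC divfK // lt0r_neq0.
Qed.

End Closure.

(** * Layers as translates of subtori *)

Section Layers.
Variables (R : realType) (l : nat).
Implicit Types (S T I : set (ivec l)) (b c e : ivec l) (th : 'cV[R]_l).
Implicit Types (z t : Point R l) (X Y : set (Point R l)).

Definition lay z S : set (Point R l) := [set t | exists2 th, orth S th & t = rot z th].

Lemma lay_refl z S : lay z S z.
Proof.
exists 0; last by rewrite rot0.
by move=> b _; rewrite /dot big1 // => i _; rewrite mxE mulr0.
Qed.

Lemma lay_torus z S : torus z -> lay z S `<=` @torus R l.
Proof. by move=> zT t [th _ ->]; exact: torus_rot. Qed.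

Lemma orthD S th ph : orth S th -> orth S ph -> orth S (th + ph).
Proof. by move=> oth oph b Sb; rewrite dotDr oth // oph // addr0. Qed.

Lemma orthN S th : orth S th -> orth S (- th).
Proof. by move=> oth b Sb; rewrite dotNr oth // oppr0. Qed.

Lemma orthZ S a th : orth S th -> orth S (a *: th).
Proof. by move=> oth b Sb; rewrite dotZr oth // mulr0. Qed.

Lemma lay_sym z t S : lay z S t -> lay t S z.
Proof. by move=> [th oth ->]; exists (- th); rewrite ?rotK //; exact: orthN. Qed.

Lemma lay_trans z t S T : T `<=` cl R S -> lay z T t -> lay t S `<=` lay z T.
Proof.
move=> TS [th oth ->] _ [ph oph ->]; exists (th + ph); last by rewrite rotD.
by apply: orthD => //; exact: orth_sub oph.
Qed.

Lemma lay_eq z t S : lay z S t -> lay t S = lay z S.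
Proof.
move=> zt; apply/seteqP; split; apply: lay_trans => //; try exact: sub_cl.
exact: lay_sym.
Qed.

Lemma lay_character z t S c : torus z -> lay z S t -> cl R S c ->
  character c t = character c z.
Proof. by move=> zT [th oth ->] Sc; rewrite character_rot // Sc // cis0 mulr1. Qed.

(** Constancy along the whole line [s *: th] gives [cis (s * dot c th) = 1] for all s, which kills
    [dot c th]; a single s would only give a multiple of 2 pi. *)
Lemma lay_constantP z S c : torus z -> char_constant_on (lay z S) c <-> cl R S c.
Proof.
move=> zT; split=> [cst th oth|Sc x y zx zy]; last first.
  by rewrite (lay_character zT zx Sc) (lay_character zT zy Sc).
apply: cis_line_eq1 => s; rewrite -dotZr; apply/(character_rot_eq c _ zT).
by apply: cst; [exists (s *: th) => //; exact: orthZ | exact: lay_refl].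
Qed.

Lemma lay_subP z z' S S' : torus z -> torus z' ->
  lay z S `<=` lay z' S' <-> lay z' S' z /\ S' `<=` cl R S.
Proof.
move=> zT zT'; split=> [sub|[z'z S'S]]; last exact: lay_trans.
split=> [|b S'b]; first exact/sub/lay_refl.
apply/(lay_constantP _ _ zT) => x y zx zy.
by rewrite !(lay_character zT' _ (@sub_cl R _ _ _ S'b)) //; exact: sub.
Qed.

Lemma lay_sub_cl z S S' : torus z -> S' `<=` cl R S <-> lay z S `<=` lay z S'.
Proof.
by move=> zT; rewrite lay_subP //; split=> [SS'|[]] //; split=> //; exact: lay_refl.
Qed.

Lemma lay_ext z S S' : S `<=` cl R S' -> S' `<=` cl R S -> lay z S = lay z S'.
Proof. by move=> SS' S'S; apply/seteqP; split; apply: lay_trans => //; exact: lay_refl. Qed.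

(** A union of images of real lines, all passing through z. *)
Lemma lay_connected z S : connected (lay z S : set 'M[R]_(l, 2)).
Proof.
have -> : lay z S = \bigcup_(th in orth S) [set rot z (s *: th) | s in setT].
  apply/seteqP; split=> [t [th oth ->]|t [th oth [s _ <-]]].
    by exists th => //; exists 1 => //; rewrite scale1r.
  by exists (s *: th) => //; exact: orthZ.
apply: bigcup_connected.
  by exists z => th _; exists 0 => //; rewrite scale0r rot0.
move=> th _; apply: connected_continuous_connected.
  by apply/connected_intervalP.
by apply: continuous_subspaceT => x; exact: rot_continuous.
Qed.

Definition coset S z : set (Point R l) :=
  [set t | torus t /\ forall b, S b -> character b t = character b z].

Lemma lay_coset z S : torus z -> lay z S `<=` coset S z.
Proof.
move=> zT t zt; split; first exact: lay_torus zt.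
by move=> b Sb; apply: (lay_character zT zt); exact: sub_cl.
Qed.

(* Near z, an angle th with small entries is orthogonal to S as soon as it
   preserves the characters in S: all <b, th> are multiples of 2 pi that are too small. *)
Lemma lay_nbhs (z : 'M[R]_(l, 2)) S : torus z ->
  exists U : set 'M[R]_(l, 2), [/\ open U, U z & U `&` coset S z `<=` lay z S].
Proof.
move=> zT; have [K K0 Korth] := @finite_orth R l S.
have p_gt0 : 0 < pi *+ 2 :> R by rewrite pmulrn_lgt0 ?pi_gt0.
have e0 : 0 < (pi *+ 2) / K%:R :> R by rewrite divr_gt0 // ltr0n.
have near_z := near_rot zT e0.
exists (interior (fun t : 'M[R]_(l, 2) => torus t -> exists2 th, t = rot z th &
  forall i, `|th i ord0| < (pi *+ 2) / K%:R)).
split; [exact: open_interior | exact: near_z |].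
move=> t [/interior_subset zt [tT tS]].
have [th tE th_lt] := zt tT; exists th => //.
apply: (Korth _ _ th_lt) => // b Sb; apply/(character_rot_eq b _ zT).
by rewrite -tE tS.
Qed.

(** Around each point t of the component C, the level set is contained in [lay t S]. These
    translates are equal or disjoint, so [lay z S] and its complement are both relatively open in C,
    and connectedness leaves only [lay z S]. *)
Lemma component_coset z S : torus z ->
  connected_component (coset S z : set 'M[R]_(l, 2)) z = lay z S.
Proof.
move=> zT; apply/seteqP; split; last first.
  apply: connected_component_max; [exact: lay_refl|exact: lay_coset|exact: lay_connected].
set C := connected_component _ _.
have Csub : C `<=` coset S z by exact: connected_component_sub.
have Cnbhs t : C t -> exists U : set 'M[R]_(l, 2),
    [/\ open U, U t & U `&` coset S z `<=` lay t S].
  move=> /Csub[tT tS]; have [U [oU Ut UE]] := lay_nbhs S tT.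
  exists U; split; [exact: oU|exact: Ut|move=> u [Uu [uT uS]]].
  apply: UE; split; first exact: Uu.
  by split; [exact: uT|move=> b Sb; exact: (etrans (uS b Sb) (esym (tS b Sb)))].
have /choice[N NP] t : exists U : set 'M[R]_(l, 2), C t ->
    [/\ open U, U t & U `&` coset S z `<=` lay t S].
  have [/Cnbhs[U UP]|nCt] := pselect (C t); first by exists U.
  by exists set0 => /nCt.
suff <- : C `&` lay z S = C by move=> t [].
apply: (@component_connected _ (coset S z : set 'M[R]_(l, 2)) z).
- exists z; split; last exact: lay_refl.
  by apply: connected_component_refl; apply: lay_coset => //; exact: lay_refl.
- exists (\bigcup_(t in C `&` lay z S) N t).
    by apply: bigcup_open => t [/NP[oN _ _] _]; exact: oN.
  apply/seteqP; split=> [t [Ct zt]|t [Ct [u [Cu zu] Nut]]].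
    have [_ Nt _] := NP t Ct; split; first exact: Ct.
    by exists t; [split; [exact: Ct|exact: zt]|exact: Nt].
  split; first exact: Ct.
  rewrite -(lay_eq zu); have [_ _ NE] := NP u Cu; apply: NE.
  by split; [exact: Nut|exact: Csub].
- exists (~` \bigcup_(t in C `\` lay z S) N t).
    by rewrite closedC; apply: bigcup_open => t [/NP[oN _ _] _]; exact: oN.
  apply/seteqP; split=> [t [Ct zt]|t [Ct nt]].
    split; first exact: Ct.
    move=> [u [Cu nzu] Nut]; apply: nzu; rewrite -(lay_eq zt); apply: lay_sym.
    have [_ _ NE] := NP u Cu; apply: NE.
    by split; [exact: Nut|exact: Csub].
  split; first exact: Ct.
  apply: contrapT => nzt; apply: nt; have [_ Nt _] := NP t Ct.
  by exists t; [split; [exact: Ct|exact: nzt]|exact: Nt].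
Qed.

(** A hypertorus is a full level set, but the intersections defining layers are built from
    components of hypertori and need only lie between [lay z S] and [coset S z]. The component
    through z is the same in this whole range. *)
Lemma component_sandwich z S (G : set 'M[R]_(l, 2)) : torus z ->
  lay z S `<=` G -> G `<=` coset S z -> connected_component G z = lay z S.
Proof.
move=> zT SG GS; apply/seteqP; split; last first.
  by apply: connected_component_max => //; [exact: lay_refl|exact: lay_connected].
rewrite -(component_coset S zT); apply: connected_component_max.
- by apply: connected_component_refl; apply/SG/lay_refl.
- by apply: (subset_trans _ GS); exact: connected_component_sub.
- exact: component_connected.
Qed.

Lemma hypertorus_componentsP b X : components (hypertorus b) X <->
  exists z, [/\ torus z, character b z = 1 & X = lay z [set b]].
Proof.
have compE z : torus z -> character b z = 1 ->
    connected_component (hypertorus b : set 'M[R]_(l, 2)) z = lay z [set b].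
  move=> zT z1; apply: component_sandwich; first exact: zT.
    move=> t /(lay_coset zT)[tT tb]; split; first exact: tT.
    by rewrite (tb b erefl) z1.
  move=> t [tT t1]; split; first exact: tT.
  by move=> _ ->; rewrite t1 z1.
split=> [[z [zT z1] ->]|[z [zT z1 ->]]].
  by exists z; split; [exact: zT|exact: z1|exact: compE].
by exists z; [split; [exact: zT|exact: z1]|rewrite (compE z zT z1)].
Qed.

Lemma arrangementP I X : toric_arrangement I X <->
  exists z b, [/\ torus z, I b, character b z = 1 & X = lay z [set b]].
Proof.
split=> [[b Ib /hypertorus_componentsP[z zP]]|[z [b [zT Ib z1 XE]]]].
  by exists z, b; case: zP => zT z1 XE; split; [exact: zT|exact: Ib|exact: z1|exact: XE].
exists b; first exact: Ib.
by apply/hypertorus_componentsP; exists z; split; [exact: zT|exact: z1|exact: XE].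
Qed.

Lemma layersP I X : layers (@toric_arrangement R l I) X <->
  exists z S, [/\ torus z, S `<=` I, (forall b, S b -> character b z = 1) & X = lay z S].
Proof.
split=> [[_ [F FA [z [zT zF] ->]]]|[z [S [zT SI S1 ->]]]].
  (* Every member of F passes through z, hence is the component at z of the hypertorus of some
     character trivial there; S collects these characters. *)
  pose S := [set b | [/\ I b, character b z = 1 & F (lay z [set b])]].
  exists z, S; split; [exact: zT|by move=> b []|by move=> b []|].
  apply: component_sandwich; first exact: zT.
    move=> t zt; split; first exact: lay_torus zt.
    move=> Y FY; have [y [b [yT Ib b1 YE]]] := (arrangementP I Y).1 (FA _ FY).
    have yz : lay y [set b] z by rewrite -YE; exact: zF.
    have bz : character b z = 1.
      by rewrite (lay_character yT yz (@sub_cl R _ _ b erefl)) b1.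
    move: t zt; rewrite YE -(lay_eq yz); apply: lay_trans; last exact: lay_refl.
    by move=> _ ->; apply: sub_cl; split; [exact: Ib|exact: bz|rewrite (lay_eq yz) -YE].
  move=> t [tT tF]; split; first exact: tT.
  move=> b [Ib b1 /tF zt]; exact: (lay_character zT zt (@sub_cl R _ _ b erefl)).
split; first by exists z; exact: lay_refl.
exists [set Y | exists2 b, S b & Y = lay z [set b]].
  move=> _ [b Sb ->]; apply/arrangementP; exists z, b.
  by split; [exact: zT|exact: SI|exact: S1|].
exists z; first by split; [exact: zT|move=> _ [b Sb ->]; exact: lay_refl].
apply/esym/component_sandwich; first exact: zT.
  move=> t zt; split; first exact: lay_torus zt.
  move=> _ [b Sb ->]; move: t zt; apply: lay_trans; last exact: lay_refl.
  by move=> _ ->; exact: sub_cl.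
move=> t [tT tF]; split; first exact: tT.
move=> b Sb; apply: (@lay_character z t [set b] b zT); last exact: sub_cl.
by apply: tF; exists b.
Qed.

Lemma codim_lay z S : torus z -> codim (lay z S) = rk R S.
Proof.
move=> zT; apply: eq_bigl => k; apply/asboolP/asboolP => -[M [Mk MS]]; exists M;
  (split; first exact: Mk); move=> r; apply/(lay_constantP _ _ zT); exact: MS.
Qed.

Lemma torus_lay : @torus R l = lay (tunit R l) set0.
Proof.
apply/seteqP; split=> [t tT|]; last exact/lay_torus/torus_tunit.
by have [th ->] := rot_surj (@torus_tunit R l) tT; exists th.
Qed.

Lemma layers_torus I : layers (@toric_arrangement R l I) (@torus R l).
Proof.
by apply/layersP; exists (tunit R l), set0; split=> //; [exact: torus_tunit|exact: torus_lay].
Qed.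

Lemma codim_torus : codim (@torus R l) = 0%N.
Proof. by rewrite torus_lay codim_lay ?rk0 //; exact: torus_tunit. Qed.

End Layers.

(** * Local structure of the poset of layers *)

Section LocallyGeometric.
Variables (R : realType) (l : nat) (I : set (ivec l)).
Implicit Types (S T : set (ivec l)) (b c e : ivec l) (th : 'cV[R]_l).
Implicit Types (z t : Point R l) (X Y : set (Point R l)).

(** The vector configuration whose flats are the layers through z. *)
Definition locus z : set (ivec l) := [set b | I b /\ character b z = 1].

Local Notation P := (layers (@toric_arrangement R l I)).

Lemma layers_lay z S : torus z -> S `<=` locus z -> P (lay z S).
Proof. by move=> zT Sz; apply/layersP; exists z, S; split=> // b /Sz[]. Qed.

Lemma layers_torus_pt {X z} : P X -> X z -> torus z.
Proof. by move=> /layersP[z0 [S [zT0 _ _ ->]]]; exact: lay_torus. Qed.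

Lemma layers_at {X z} : P X -> X z -> exists2 S, S `<=` locus z & X = lay z S.
Proof.
move=> /layersP[z0 [S [zT0 SI S1 ->]]] z0z; exists S; last by rewrite (lay_eq z0z).
move=> b Sb; split; first exact: SI.
by rewrite (lay_character zT0 z0z) ?S1 //; exact: sub_cl.
Qed.

Lemma layers_pt {X} : P X -> exists z, X z.
Proof. by case=> -[z Xz] _; exists z. Qed.

Lemma is_join_lay {x a b : set (Point R l)} {z A B} :
  P x -> x z -> A `<=` locus z -> B `<=` locus z ->
  a = lay z A -> b = lay z B -> x `<=` a -> x `<=` b ->
  is_join (below P (@layer_le R l) x) (@layer_le R l) a b (lay z (A `|` B)).
Proof.
move=> Px xz Az Bz -> -> xa xb; have zT := layers_torus_pt Px xz.
have [X Xz xE] := layers_at Px xz.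
rewrite xE in xa xb; have AX := (lay_sub_cl X A zT).2 xa; have BX := (lay_sub_cl X B zT).2 xb.
split.
- split; first by apply: layers_lay => // c [/Az|/Bz].
  by rewrite /layer_le xE; apply/lay_sub_cl => // c [/AX|/BX].
- by apply/lay_sub_cl => //; apply: sub_cl_trans => c; left.
- by apply/lay_sub_cl => //; apply: sub_cl_trans => c; right.
move=> u [Pu xu] au bu; have uz : u z by exact: xu.
have [C Cz uE] := layers_at Pu uz; rewrite /layer_le uE in au bu *.
apply/lay_sub_cl => // c [Ac|Bc].
  exact: ((lay_sub_cl _ _ zT).2 au _ Ac).
exact: ((lay_sub_cl _ _ zT).2 bu _ Bc).
Qed.

(** The intersection of two spans need not be spanned by characters of I; the meet is the flat of
    those members of [locus z] that lie in it. *)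
Lemma is_meet_lay {x a b : set (Point R l)} {z A B} :
  P x -> x z -> A `<=` locus z -> B `<=` locus z ->
  a = lay z A -> b = lay z B -> x `<=` a -> x `<=` b ->
  is_meet (below P (@layer_le R l) x) (@layer_le R l) a b
    (lay z (locus z `&` (cl R A `&` cl R B))).
Proof.
move=> Px xz Az Bz -> -> xa xb; have zT := layers_torus_pt Px xz.
have leA : lay z A `<=` lay z (locus z `&` (cl R A `&` cl R B)).
  by apply/lay_sub_cl => // c [_ []].
split=> //.
- split; first by apply: layers_lay => // c [].
  exact: (subset_trans xa).
- by apply/lay_sub_cl => // c [_ []].
move=> u [Pu xu] ua ub; have uz : u z by exact: xu.
have [C Cz uE] := layers_at Pu uz; rewrite /layer_le uE in ua ub *.
apply/lay_sub_cl => // c Cc; apply: sub_cl; split; first exact: Cz.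
split; [exact: ((lay_sub_cl _ _ zT).2 ua _ Cc)|exact: ((lay_sub_cl _ _ zT).2 ub _ Cc)].
Qed.

Lemma is_join_uniq {Q : set (set (Point R l))} {a b j j' : set (Point R l)} :
  is_join Q (@layer_le R l) a b j -> is_join Q (@layer_le R l) a b j' -> j = j'.
Proof.
by move=> [Sj aj bj jm] [Sj' aj' bj' jm']; apply/seteqP; split; [apply: jm'|apply: jm].
Qed.

Lemma is_meet_uniq {Q : set (set (Point R l))} {a b j j' : set (Point R l)} :
  is_meet Q (@layer_le R l) a b j -> is_meet Q (@layer_le R l) a b j' -> j = j'.
Proof.
by move=> [Sj aj bj jm] [Sj' aj' bj' jm']; apply/seteqP; split; [apply: jm|apply: jm'].
Qed.

(** At a point z of x this is the lattice of flats of [locus z]: atoms come from single nonzero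
    characters, and the rank inequality is the submodularity of [rk]. *)
Lemma layers_geometric x : P x ->
  is_geometric_lattice (below P (@layer_le R l) x) (@layer_le R l) (@codim R l) (@torus R l).
Proof.
move=> Px; have [z xz] := layers_pt Px; have zT := layers_torus_pt Px xz.
split.
- move=> a b [Pa xa] [Pb xb].
  have [A Az aE] := layers_at Pa (xa _ xz); have [B Bz bE] := layers_at Pb (xb _ xz).
  split; [exists (lay z (A `|` B))|exists (lay z (locus z `&` (cl R A `&` cl R B)))].
    exact: (is_join_lay Px xz Az Bz aE bE xa xb).
  exact: (is_meet_lay Px xz Az Bz aE bE xa xb).
- move=> y [Py xy]; split; first by split=> // a [].
  move=> u [[Pu xu] u_ub]; have uz := xu _ xz.
  have [C Cz uE] := layers_at Pu uz; have [B Bz yE] := layers_at Py (xy _ xz).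
  rewrite /layer_le yE uE; apply/lay_sub_cl => // b Bb.
  (* Only the zero character lies in [cl R set0]; it imposes no condition and gives no atom. *)
  have [b0|nb0] := pselect (cl R set0 b).
    by apply: cl_sub b0 => ? [].
  suff /u_ub : [set a | is_atom (below P (@layer_le R l) x) (@layer_le R l) (@torus R l) a /\
      layer_le a y] (lay z [set b]).
    by rewrite /layer_le uE => /(lay_sub_cl _ _ zT).2; apply.
  have by' : layer_le (lay z [set b]) y.
    by rewrite /layer_le yE; apply/lay_sub_cl => // _ ->; exact: sub_cl.
  split=> //; split.
  + by split; [exact: layers_torus|move=> t; exact: layers_torus_pt Px].
  + split; first by apply: layers_lay => // _ ->; exact: Bz.
    exact: (subset_trans xy).
  + split; first exact: lay_torus.
    move=> bE; apply: nb0; suff /(_ b erefl) : [set b] `<=` cl R set0 by [].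
    apply/(lay_sub_cl _ _ zT); rewrite -bE; exact: lay_torus.
  move=> [v [[Pv xv] [tv ntv] [vb nvb]]].
  have [V Vz vE] := layers_at Pv (xv _ xz).
  rewrite /layer_le vE in vb; have Vb := (lay_sub_cl _ _ zT).2 vb.
  (* A layer strictly between the torus and [lay z [set b]] would have a span strictly between zero
     and a line. *)
  have [V0|nV0] := pselect (V `<=` cl R set0).
    apply: ntv; rewrite vE; apply/seteqP; split; last exact: lay_torus.
    move=> t tT; have [th ->] := rot_surj zT tT; exists th => //.
    by apply: (orth_sub V0) => ? [].
  apply: nvb; rewrite vE; apply: lay_ext => //; apply: (rk_eq Vb).
  apply: (leq_trans (rk1_le R b)); rewrite lt0n; apply/eqP => V0; apply: nV0.
  by apply: (@rk_eq _ _ set0); [move=> ? []|rewrite V0].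
move=> a b j m [Pa xa] [Pb xb].
have [A Az aE] := layers_at Pa (xa _ xz); have [B Bz bE] := layers_at Pb (xb _ xz).
move=> /is_join_uniq/(_ (is_join_lay Px xz Az Bz aE bE xa xb)) ->.
move=> /is_meet_uniq/(_ (is_meet_lay Px xz Az Bz aE bE xa xb)) ->.
by rewrite aE bE !codim_lay //; apply: rk_submod => c [_ []].
Qed.

Lemma codim_ltn X Y : P X -> P Y -> Y `<=` X -> X <> Y -> (codim X < codim Y)%N.
Proof.
move=> PX PY YX XY; have [z Yz] := layers_pt PY; have zT := layers_torus_pt PY Yz.
have [S Sz XE] := layers_at PX (YX _ Yz); have [T Tz YE] := layers_at PY Yz.
rewrite XE YE !codim_lay // ltnNge; apply/negP => rkTS; apply: XY.
rewrite XE YE in YX *; have ST := (lay_sub_cl _ _ zT).2 YX.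
by apply: lay_ext => //; exact: rk_eq.
Qed.

Lemma layers_locally_geometric : finite_set P ->
  locally_geometric P (@layer_le R l) (@codim R l) (@torus R l).
Proof.
move=> finP; split=> //.
- split=> [x _ //|x y Px Py xy yx|x y z Px Py Pz xy yz]; first by apply/seteqP.
  exact: (subset_trans yz).
- by split; [exact: layers_torus|move=> x Px z; exact: layers_torus_pt Px].
- exact: codim_torus.
split; last exact: layers_geometric.
move=> X Y [PX PY [YX XY] nZ].
have [z Yz] := layers_pt PY; have zT := layers_torus_pt PY Yz.
have [S Sz XE] := layers_at PX (YX _ Yz); have [T Tz YE] := layers_at PY Yz.
rewrite /layer_le XE YE in YX; have ST := (lay_sub_cl _ _ zT).2 YX.
(* A character of T outside the span of S raises the rank by exactly one, so in a covering relation
   it already yields Y. *)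
have /existsNP[b /not_implyP[Tb nSb]] : ~ (T `<=` cl R S).
  by move=> TS; apply: XY; rewrite XE YE; exact: lay_ext.
have ZY : Y `<=` lay z (S `|` [set b]).
  by rewrite YE; apply/lay_sub_cl => // c [/ST//|->]; exact: sub_cl.
have ZX : lay z (S `|` [set b]) `<=` X.
  by rewrite XE; apply/lay_sub_cl => //; apply: sub_cl_trans => c; left.
have [<-|nZY] := pselect (lay z (S `|` [set b]) = Y).
  by rewrite XE !codim_lay // rkU1.
case: nZ; exists (lay z (S `|` [set b])); split=> //.
  by apply: layers_lay => // c [/Sz//|->]; exact: Tz.
split=> // XZ; apply: nSb; move: (XZ); rewrite XE => XZ'.
have : lay z S `<=` lay z (S `|` [set b]) by rewrite -XZ'.
by move=> /(lay_sub_cl _ _ zT).2; apply; right.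
Qed.

End LocallyGeometric.

(** * Fibrations of layers *)

Section Fibration.
Variables (R : realType) (l : nat).
Implicit Types (X Y a : set (Point R l)) (P Q A : set (set (Point R l))).

(* Every layer in P either belongs to Q or is cut out of a layer in Q by an
   element of A, which is transversal to all of Q. *)
Definition fibration P Q A :=
  [/\ Q `<=` P, Q (@torus R l),
    (forall Y a, Q Y -> A a ->
       [/\ P (Y `&` a), ~ Q (Y `&` a), codim (Y `&` a) = (codim Y).+1 &
           forall Y', Q Y' -> Y `&` a `<=` Y' -> Y `<=` Y']) &
    (forall X, P X -> exists Y,
       [/\ Q Y, X `<=` Y, (forall Y', Q Y' -> X `<=` Y' -> Y `<=` Y'),
           (forall a, A a -> X `<=` a -> X = Y `&` a) &
           X = Y \/ exists2 a, A a & X `<=` a])].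

End Fibration.

(** * Fibrations obtained by forgetting one coordinate *)

Section CoordinateFibration.
Variables (R : realType) (l : nat) (I J : set (ivec l)) (i : 'I_l).
Implicit Types (S T : set (ivec l)) (b c e f : ivec l) (th : 'cV[R]_l).
Implicit Types (z t : Point R l) (X Y a : set (Point R l)).

Hypothesis JI : J `<=` I.
Hypothesis Ji : forall b, J b -> b i = 0.
Hypothesis Eprim : forall e, (I `\` J) e ->
  exists f m, [/\ (0 < m)%N, e = f *+ m & f i = 1].
(* The graphs of two elements of I \ J through a common point intersect inside
   a hypertorus of J. *)
Hypothesis Echord : forall e f, (I `\` J) e -> (I `\` J) f -> e <> f ->
  exists b (p q : int), [/\ J b, q != 0 & b = e *~ p + f *~ q].

Local Notation P := (layers (@toric_arrangement R l I)).
Local Notation Q := (layers (@toric_arrangement R l J)).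
Local Notation A := (@toric_arrangement R l (I `\` J)).

Let dl : 'cV[R]_l := delta_mx i ord0.

Lemma orth_dl S (a : R) : S `<=` J -> orth S (a *: dl).
Proof. by move=> SJ b /SJ/Ji b0; rewrite dotZr dot_delta b0 mulr0. Qed.

(* Correcting th by a multiple of dl makes it orthogonal to e without changing
   its products with S, since f i = 1. *)
Lemma cl_cone S e b : S `<=` J -> (I `\` J) e -> b i = 0 ->
  cl R (S `|` [set e]) b -> cl R S b.
Proof.
move=> SJ /Eprim[f [m [m0 eE fi]]] bi Sb th oth.
have : dot b (th - dot f th *: dl) = 0.
  apply: Sb => c [Sc|->].
    by apply: orthD Sc => //; apply: orthN; exact: orth_dl.
  by rewrite eE dotMn dot_retract // mulr0.
by rewrite dotDr dotNr dotZr dot_delta bi mulr0 subr0.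
Qed.

Lemma not_clE S e : S `<=` J -> (I `\` J) e -> ~ cl R S e.
Proof.
move=> SJ /Eprim[f [m [m0 eE fi]]] /(_ dl).
have -> : dl = 1 *: dl by rewrite scale1r.
move=> /(_ (orth_dl 1 SJ)); rewrite eE => /(dotMn_eq0 m0).
by rewrite dotZr dot_delta fi mulr1 => /eqP; rewrite oner_eq0.
Qed.

(** The intersection stays connected. If th is orthogonal to S and leads to a point of the graph,
    subtracting [dot f th] in coordinate i makes it orthogonal to e too. It remains orthogonal to S,
    and the point does not move because f has the same value there as at w. *)
Lemma lay_setI (w : Point R l) S e : torus w -> S `<=` J -> (I `\` J) e ->
  lay w S `&` lay w [set e] = lay w (S `|` [set e]).
Proof.
move=> wT SJ Ee; apply/seteqP; split; last first.
  move=> t wt; split; move: t wt; apply/lay_sub_cl; try exact: wT.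
    by apply: sub_cl_trans => c; left.
  by apply: sub_cl_trans => c; right.
have [f [m [m0 eE fi]]] := Eprim Ee.
move=> t [[th oth ->] wt].
have /(character_rot_eq f _ wT) fth : character f (rot w th) = character f w.
  apply: (lay_character wT wt) => ph oph; apply: (dotMn_eq0 m0).
  by rewrite -eE; exact: oph.
exists (th - dot f th *: dl).
  move=> c [Sc|->].
    by apply: orthD Sc => //; apply: orthN; exact: orth_dl.
  by rewrite eE dotMn dot_retract // mulr0.
by rewrite rot_retract.
Qed.

Lemma layers_graph Y a : Q Y -> A a -> exists w S e,
  [/\ torus w, S `<=` J, (forall b, S b -> character b w = 1) &
      [/\ (I `\` J) e, character e w = 1, Y = lay w S & a = lay w [set e]]].
Proof.
move=> QY /arrangementP[p [e [pT Ee e1 aE]]].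
have [q Yq] := layers_pt QY; have qT := layers_torus_pt QY Yq.
have [S Sq YE] := layers_at QY Yq.
have SJ : S `<=` J by move=> b /Sq[].
have [f [m [m0 eE fi]]] := Eprim Ee.
have [th pE] := rot_surj qT pT.
(* The angle th leads from q to p. Turning only coordinate i of q by [dot f th] stays in Y, since J
   ignores that coordinate, and gives f its value at p, so the new point also lies on a. *)
have qw : lay q S (rot q (dot f th *: dl)) by exists (dot f th *: dl) => //; exact: orth_dl.
have pw : lay p [set e] (rot q (dot f th *: dl)).
  exists (dot f th *: dl - th); last by rewrite pE rotD [th + _]addrC subrK.
  by move=> _ ->; rewrite eE dotMn dotDr dotNr dotZr dot_delta fi mulr1 subrr mulr0.
exists (rot q (dot f th *: dl)), S, e; split.
- exact: torus_rot.
- exact: SJ.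
- by move=> b Sb; rewrite (lay_character qT qw (@sub_cl R _ _ b Sb)); have [] := Sq b Sb.
split.
- exact: Ee.
- by rewrite (lay_character pT pw (@sub_cl R _ _ e erefl)).
- by rewrite (lay_eq qw).
- by rewrite (lay_eq pw).
Qed.

Lemma layers_sub : Q `<=` P.
Proof.
move=> X /layersP[z [S [zT SJ S1 XE]]]; apply/layersP; exists z, S; split.
- exact: zT.
- exact: (subset_trans SJ).
- exact: S1.
- exact: XE.
Qed.

Lemma layers_fibration : fibration P Q A.
Proof.
split; [exact: layers_sub|exact: layers_torus| |].
  move=> Y a QY Aa; have [w [S [e [wT SJ S1 [Ee e1 YE aE]]]]] := layers_graph QY Aa.
  have yaE : Y `&` a = lay w (S `|` [set e]) by rewrite YE aE lay_setI.
  have minY Y' : Q Y' -> Y `&` a `<=` Y' -> Y `<=` Y'.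
    move=> QY' yaY'; have Y'w : Y' w by apply: yaY'; rewrite yaE; exact: lay_refl.
    have [S' S'w Y'E] := layers_at QY' Y'w.
    rewrite yaE Y'E in yaY'; rewrite YE Y'E; apply/(lay_sub_cl _ _ wT) => b S'b.
    have [Jb _] := S'w b S'b.
    apply: (cl_cone SJ Ee (Ji Jb)); exact: ((lay_sub_cl _ _ wT).2 yaY').
  split; last exact: minY.
  - rewrite yaE; apply: (layers_lay wT) => b [Sb|->]; split.
    + exact/JI/SJ.
    + exact: S1.
    + by case: Ee.
    + exact: e1.
  - move=> Qya; have /(_ _) := minY _ Qya; move=> /(_ (fun t h => h)) Ysub.
    have wSe : lay w S `<=` lay w [set e].
      move=> t wt; rewrite -aE; have [] : (Y `&` a) t by apply: Ysub; rewrite YE.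
      by [].
    apply: (not_clE SJ Ee); exact: ((lay_sub_cl S [set e] wT).2 wSe e erefl).
  by rewrite yaE YE !codim_lay // rkU1 //; exact: not_clE.
move=> X PX; have [z Xz] := layers_pt PX; have zT := layers_torus_pt PX Xz.
have [S Sz XE] := layers_at PX Xz.
(* The projection of X comes from the flat of J inside the span of S. *)
pose T := [set b | [/\ J b, character b z = 1 & cl R S b]].
exists (lay z T); split.
- by apply: (layers_lay zT) => b [].
- by rewrite XE; apply/(lay_sub_cl _ _ zT) => b [].
- move=> Y' QY' XY'; have [S' S'z Y'E] := layers_at QY' (XY' _ Xz).
  rewrite Y'E; apply/(lay_sub_cl _ _ zT) => b S'b; apply: sub_cl.
  have [Jb b1] := S'z b S'b; split; [exact: Jb|exact: b1|].
  rewrite XE Y'E in XY'; exact: ((lay_sub_cl _ _ zT).2 XY' b S'b).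
- move=> a /arrangementP[p [e [pT Ee e1 aE]]] Xa.
  have pz : lay p [set e] z by rewrite -aE; exact: Xa.
  have ez : character e z = 1 by rewrite (lay_character pT pz (@sub_cl R _ _ e erefl)).
  have aE' : a = lay z [set e] by rewrite aE (lay_eq pz).
  have Se : cl R S e.
    rewrite XE aE' in Xa; exact: ((lay_sub_cl _ _ zT).2 Xa e erefl).
  have TJ : T `<=` J by move=> b [].
  rewrite aE' (lay_setI zT TJ Ee) XE; apply: lay_ext; last by move=> b [[]|->].
  move=> b Sb; have [Ib b1] := Sz b Sb.
  have [Jb|nJb] := pselect (J b).
    by apply: sub_cl; left; split; [exact: Jb|exact: b1|exact: sub_cl].
  have [<-|eb] := pselect (e = b); first by apply: sub_cl; right.
  (* The character c of J is trivial at z and lies in the span of S, so it belongs to T. As b has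
     the nonzero coefficient q in c, dividing by q puts b in the span of T and e. *)
  have [c [p' [q [Jc q0 cE]]]] := Echord Ee (conj Ib nJb) eb.
  have Tc : T c.
    split; first exact: Jc.
    - have [th zE] := character_torus zT.
      rewrite zE cE dotDl !dotMzl cisD !cisMz -!zE.
      by rewrite ez b1 !exp1rz mulr1.
    - move=> th oth; rewrite cE dotDl !dotMzl Se // oth //.
      by rewrite !mulr0 addr0.
  move=> th oth.
  have := oth c (or_introl Tc); rewrite cE dotDl !dotMzl (oth e (or_intror erefl)).
  by rewrite mulr0 add0r => /eqP; rewrite mulf_eq0 intr_eq0 (negPf q0) => /eqP.
have [[b Sb nJb]|nS] := pselect (exists2 b, S b & ~ J b).
  right; exists (lay z [set b]).
    have [Ib b1] := Sz b Sb; apply/arrangementP; exists z, b.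
    by split; [exact: zT|split|exact: b1|].
  by rewrite XE; apply/(lay_sub_cl _ _ zT) => _ ->; exact: sub_cl.
left; rewrite XE; apply: lay_ext; last by move=> b [].
move=> b Sb; apply: sub_cl; have [Ib b1] := Sz b Sb.
split; [|exact: b1|exact: sub_cl].
by apply: contrapT => nJb; apply: nS; exists b.
Qed.

End CoordinateFibration.

(** * TM-ideals from fibrations *)

Section FibrationTheory.
Variables (R : realType) (l : nat) (P Q A : set (set (Point R l))).
Implicit Types (X Y Z a x y z u : set (Point R l)).

Hypothesis fibPQA : fibration P Q A.
Hypothesis A_torus : forall a, A a -> a `<=` @torus R l.

Local Notation le := (@layer_le R l).
Local Notation rank := (@codim R l).
Local Notation bot := (@torus R l).

Let QP : Q `<=` P. Proof. by case: fibPQA. Qed.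
Let Qbot : Q bot. Proof. by case: fibPQA. Qed.

Let cut Y a : Q Y -> A a ->
  [/\ P (Y `&` a), ~ Q (Y `&` a), rank (Y `&` a) = (rank Y).+1 &
      forall Y', Q Y' -> Y `&` a `<=` Y' -> Y `<=` Y'].
Proof. by case: fibPQA => _ _ + _; apply. Qed.

Let base X : P X -> exists Y,
  [/\ Q Y, X `<=` Y, (forall Y', Q Y' -> X `<=` Y' -> Y `<=` Y'),
      (forall a, A a -> X `<=` a -> X = Y `&` a) & X = Y \/ exists2 a, A a & X `<=` a].
Proof. by case: fibPQA => _ _ _; apply. Qed.

Let cut_not_sub Y a : Q Y -> A a -> ~ (Y `<=` a).
Proof.
move=> QY Aa Ya; have [_ nQ _ _] := cut QY Aa; apply: nQ.
by rewrite (_ : Y `&` a = Y) //; apply/setIidl.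
Qed.

Let bot_cut a : A a -> bot `&` a = a.
Proof. by move=> Aa; apply/setIidr; exact: A_torus. Qed.

Let A_P a : A a -> P a.
Proof. by move=> Aa; rewrite -(bot_cut Aa); have [] := cut Qbot Aa. Qed.

(** A layer of P outside Q lies in some element of A, while no layer of Q does. *)
Lemma fibration_ideal X Y : P X -> Q Y -> Y `<=` X -> Q X.
Proof.
move=> PX QY YX; have [Z [QZ XZ _ _ []]] := base PX; first by move=> ->.
by move=> [a Aa Xa]; case: (cut_not_sub QY Aa); exact: subset_trans Xa.
Qed.

Lemma fibration_maximal x : A !=set0 -> is_maximal P le x ->
  exists Y a, [/\ is_maximal Q le Y, A a, x = Y `&` a &
                  forall Y', Q Y' -> x `<=` Y' -> Y `<=` Y'].
Proof.
move=> [a0 Aa0] [Px xmax]; have [Y [QY xY Ymin Ya xYa]] := base Px.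
have [a Aa xa] : exists2 a, A a & x `<=` a.
  (* If x were in Q, cutting it by a0 would give a strictly larger element of P. *)
  case: xYa => [xE|//]; have [PY nQ _ _] := cut QY Aa0.
  have /(xmax _ PY) YE : le x (Y `&` a0) by rewrite xE; exact: subIsetl.
  by case: nQ; rewrite YE xE.
exists Y, a; split=> //; last exact: Ya.
split=> // Y1 QY1 Y1Y; have [PY1a _ _ Y1min] := cut QY1 Aa.
have xE := Ya a Aa xa.
have Y1aE : Y1 `&` a = x.
  apply: xmax PY1a _; rewrite /layer_le xE; exact: setSI.
apply/seteqP; split=> //; apply: Ymin => //.
by rewrite -Y1aE; exact: subIsetl.
Qed.

Lemma fibration_pure r : A !=set0 ->
  (forall x, is_maximal Q le x -> rank x = r) ->
  forall x, is_maximal P le x -> rank x = r.+1.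
Proof.
move=> A0 Qr x /(fibration_maximal A0)[Y [a [Ymax Aa -> _]]].
by have [QY _] := Ymax; have [_ _ -> _] := cut QY Aa; rewrite Qr.
Qed.

Lemma fibration_rank r : A !=set0 -> rank_is Q rank r -> rank_is P rank r.+1.
Proof.
move=> [a0 Aa0] [[Y [QY rY]] Qr]; split.
  by exists (Y `&` a0); have [PY _ -> _] := cut QY Aa0; rewrite rY.
move=> X PX; have [Z [QZ XZ _ Za XE]] := base PX.
case: XE => [->|[a Aa Xa]]; first by apply: (leq_trans (Qr _ QZ)).
by rewrite (Za a Aa Xa); have [_ _ -> _] := cut QZ Aa; rewrite ltnS Qr.
Qed.

Lemma fibration_finite : finite_set Q -> finite_set A -> finite_set P.
Proof.
move=> finQ finA.
apply: (@sub_finite_set _ _ (Q `|` [set Y `&` a | Y in Q & a in A])).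
  move=> X PX; have [Z [QZ XZ _ Za [->|[a Aa Xa]]]] := base PX; first by left.
  by right; exists Z => //; exists a => //; rewrite (Za a Aa Xa).
by rewrite finite_setU; split=> //; exact: finite_image2.
Qed.

Lemma fibration_TM_ideal r : A !=set0 ->
  (forall x, is_maximal Q le x -> rank x = r) ->
  is_TM_ideal P le rank bot Q.
Proof.
move=> A0 Qr; split.
- by split=> // x y Qy Px; exact: fibration_ideal.
- by move=> x y /Qr -> /Qr ->.
- move=> T TQ z [[Pz z_ub] zmin]; have [Y [QY zY Ymin _ _]] := base Pz.
  suff <- : Y = z by [].
  apply: zmin => //; split; first exact: QP.
  by move=> t Tt; apply: Ymin; [exact: TQ|exact: z_ub].
- move=> a y [Pbot Pa [_ bot_a] acov] nQa Qy.
  (* An atom outside Q is contained in some element a' of A. Since a' is not the whole torus, the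
     covering relation forces equality. *)
  have Aa : A a.
    have [Z [QZ aZ _ Za [aE|[a' Aa' aa']]]] := base Pa; first by rewrite aE in nQa.
    suff -> : a = a' by [].
    apply: contrapT => naa'; apply: acov; exists a'; split.
    + exact: A_P.
    + split; first exact: A_torus.
      by move=> bE; apply: (cut_not_sub Qbot Aa'); rewrite -bE.
    + by split=> // /esym.
  (* Every upper bound of a and y is contained in their intersection, which is itself a layer; so
     there is only one minimal upper bound. *)
  have [Pya _ _ _] := cut Qy Aa.
  have ya_ub u : is_ub P le [set a; y] u -> le (y `&` a) u.
    by move=> [_ u_ub]; rewrite /layer_le subsetI; split; apply: u_ub; [right|left].
  have ya_is_ub : is_ub P le [set a; y] (y `&` a).
    by split=> // t [->|->]; [exact: subIsetr|exact: subIsetl].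
  exists (y `&` a); split.
    split=> // u uub ule; apply/seteqP; split=> //; exact: ya_ub.
  move=> u [uub umin]; apply: umin => //; exact: ya_ub.
- move=> x xmax; have [Y [a [Ymax Aa xE Ymin]]] := fibration_maximal A0 xmax.
  have [QY _] := Ymax; have [Px _] := xmax.
  have xY : x `<=` Y by rewrite xE; exact: subIsetl.
  exists Y; split=> //; split; first by split; [exact: QP|].
  (* For every layer u containing x, the meet of Y and u is the projection of u to Q. *)
  have meetE u v : P u -> x `<=` u -> is_meet (below P le x) le Y u v ->
      [/\ Q v, u `<=` v & forall Y', Q Y' -> u `<=` Y' -> v `<=` Y'].
    move=> Pu xu [[Pv xv] Yv uv vmax]; have Qv : Q v by exact: (fibration_ideal Pv QY Yv).
    split=> // Y' QY' uY'; apply: vmax => //.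
      by split; [exact: QP|exact: subset_trans uY'].
    by apply: Ymin => //; exact: subset_trans uY'.
  move=> w z [Pw xw] [Pz xz] zY j m m' j' [[Pj xj] wj zj jmin] mm mm' [[Pj' xj'] m'j' zj' j'min].
  have Qz : Q z by exact: (fibration_ideal Pz QY zY).
  have [Qm jm mmin] := meetE _ _ Pj xj mm.
  have [Qm' wm' m'min] := meetE _ _ Pw xw mm'.
  (* The projection V of j' is still an upper bound of m' and z, both of which are in Q, so it
     equals their join. *)
  have Qj' : Q j'.
    have [V [QV j'V Vmin _ _]] := base Pj'.
    suff <- : V = j' by [].
    apply/seteqP; split=> //; apply: j'min.
    + by split; [exact: QP|exact: (subset_trans xj' j'V)].
    + exact: Vmin.
    + exact: Vmin.
  apply/seteqP; split.
    apply: mmin; first exact: Qj'.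
    by apply: j'min; [split|exact: (subset_trans wj wm')|exact: zj].
  have [V [QV wV Vmin Va [wE|[b Ab wb]]]] := base Pw.
    have Qw : Q w by rewrite wE.
    apply: (subset_trans _ jm).
    by apply: jmin; [split|exact: (subset_trans m'j' (m'min _ Qw _))|exact: zj'].
  (* When w lies on a graph b, intersecting j' with b gives an upper bound of w and z. It is
     contained in j, hence in m, and transversality removes b: j' is contained in m. *)
  have [Pj'b _ _ j'bmin] := cut Qj' Ab.
  apply: j'bmin; first exact: Qm.
  apply: (subset_trans _ jm); apply: jmin.
  + by split=> //; rewrite /layer_le subsetI; split=> //; exact: (subset_trans xw wb).
  + rewrite /layer_le (Va b Ab wb) => t [j't bt]; split; last exact: bt.
    exact: (m'min _ QV wV _ (m'j' _ j't)).
  + by move=> t [j't _]; exact: zj'.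
Qed.

End FibrationTheory.

Lemma fsumrN (V : zmodType) (T : choiceType) (D : set T) (f : T -> V) :
  finite_set D -> \sum_(x \in D) - f x = - \sum_(x \in D) f x.
Proof. by move=> finD; rewrite !fsbig_finite // sumrN. Qed.

(** * Moebius function and characteristic polynomial of a fibration *)

Section FibrationCharpoly.
Variables (R : realType) (l : nat) (P Q : set (set (Point R l))) (s : seq (set (Point R l))).
Implicit Types (X Y Z a : set (Point R l)).

Local Notation le := (@layer_le R l).
Local Notation rank := (@codim R l).
Local Notation bot := (@torus R l).

Hypothesis fibPQ : fibration P Q [set` s].
Hypothesis s_uniq : uniq s.
Hypothesis s_torus : forall a, a \in s -> a `<=` bot.
Hypothesis P_fin : finite_set P.
Hypothesis P_mono : forall X Y, P X -> P Y -> Y `<=` X -> X <> Y -> (rank X < rank Y)%N.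

Let QP : Q `<=` P. Proof. by case: fibPQ. Qed.
Let Qbot : Q bot. Proof. by case: fibPQ. Qed.

Let cut Y a : Q Y -> a \in s ->
  [/\ P (Y `&` a), ~ Q (Y `&` a), rank (Y `&` a) = (rank Y).+1 &
      forall Y', Q Y' -> Y `&` a `<=` Y' -> Y `<=` Y'].
Proof. by case: fibPQ => _ _ + _; apply. Qed.

Definition is_projection (pi : set (Point R l) -> set (Point R l)) := forall X, P X ->
  [/\ Q (pi X), X `<=` pi X, (forall Y', Q Y' -> X `<=` Y' -> pi X `<=` Y'),
      (forall a, a \in s -> X `<=` a -> X = pi X `&` a) &
      ~ Q X -> exists2 a, a \in s & X `<=` a].

Lemma fibration_projection : exists pi, is_projection pi.
Proof.
have base : forall X, exists Y, P X -> [/\ Q Y, X `<=` Y, (forall Y', Q Y' -> X `<=` Y' -> Y `<=` Y'),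
      (forall a, a \in s -> X `<=` a -> X = Y `&` a) &
      ~ Q X -> exists2 a, a \in s & X `<=` a].
  move=> X; have [PX|nPX] := pselect (P X); last by exists X.
  have [_ _ _ /(_ X PX)[Y [QY XY Ymin Ya XE]]] := fibPQ.
  exists Y => _; split=> // nQX; by case: XE => // XE; rewrite XE in nQX.
by have [pi piP] := choice base; exists pi.
Qed.

Definition cover_count X := count (fun a => `[< X `<=` a >]) s.

Lemma mulr_cover_count (V : zmodType) (x : V) X :
  x *+ cover_count X = \sum_(a <- s) (if `[< X `<=` a >] then x else 0).
Proof.
by rewrite -big_mkcond /= big_const_seq iter_addr_0.
Qed.

(** Double counting of the pairs formed by a layer X and a graph a containing it: for fixed a,
    intersection with a is a bijection from Q to the layers of P inside a, with the projection as
    inverse. *)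
Lemma fibration_sum (V : zmodType) (h : set (Point R l) -> V) (W : set (set (Point R l))) :
  \sum_(X \in (P `\` Q) `&` W) h X *+ cover_count X =
  \sum_(a <- s) \sum_(Y \in [set Y | Q Y /\ W (Y `&` a)]) h (Y `&` a).
Proof.
have [pi piP] := fibration_projection.
have B_fin : finite_set ((P `\` Q) `&` W) by apply: sub_finite_set P_fin => X [[]].
under eq_fsbigr do rewrite mulr_cover_count fsbig_seq //.
rewrite exchange_fsbig // -fsbig_seq // [LHS]big_seq [RHS]big_seq.
apply: eq_bigr => a sa.
transitivity (\sum_(X \in ((P `\` Q) `&` W) `&` [set X | X `<=` a]) h X).
  rewrite [RHS]fsbig_mkcondr; apply: eq_fsbigr => X _.
  by case: asboolP => Xa; [rewrite mem_set|rewrite memNset].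
apply: (reindex_fsbig (fun Y => Y `&` a)); split.
- move=> Y [QY WYa]; have [PYa nQYa _ _] := cut QY sa.
  by split; [split=> //; split|exact: subIsetr].
- move=> Y Y'; rewrite !inE => -[QY _] [QY' _] YaE.
  have [_ _ _ Ymin] := cut QY sa; have [_ _ _ Y'min] := cut QY' sa.
  apply/seteqP; split; first by apply: Ymin; rewrite // YaE; exact: subIsetl.
  by apply: Y'min; rewrite // -YaE; exact: subIsetl.
- move=> X [[[PX nQX] WX] Xa]; have [QpX XpX pXmin pXa _] := piP X PX.
  by exists (pi X); [split=> //=; rewrite -(pXa a sa Xa)|rewrite -(pXa a sa Xa)].
Qed.

Lemma fibration_moebius mu : is_moebius P le bot mu -> is_moebius Q le bot mu.
Proof.
move=> [mu_bot mu_sum]; split=> // X QX Xbot.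
apply: (etrans _ (mu_sum X (QP QX) Xbot)); apply: eq_fsbigl; apply/seteqP; split=> Z [].
  by move=> QZ ZX; split=> //; exact: QP.
move=> PZ ZX; split=> //.
by apply: (fibration_ideal fibPQ) QX ZX.
Qed.

(** Strong induction on the rank, using that mu sums to zero over the layers containing X. The part
    in Q sums to d, taken over the layers of Q containing [pi X]. By [fibration_sum] the claimed
    values on the other layers sum to minus [d *+ cover_count X]. It remains to see that this is
    minus d, so that the term of X has to be the claimed one. *)
Lemma moebius_fiber mu pi : is_moebius P le bot mu -> is_projection pi ->
  forall X, P X -> ~ Q X -> mu X = - (mu (pi X) *+ cover_count X).
Proof.
move=> mu_moeb piP X; have [n] := ubnP (rank X); elim: n X => // n IHn X rX PX nQX.
have [mu_bot mu_sum] := mu_moeb; have [_ muQ_sum] := fibration_moebius mu_moeb.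
have [QpX XpX pXmin pXa /(_ nQX)[a0 sa0 Xa0]] := piP X PX.
have X_bot : X <> bot by move=> XE; apply: nQX; rewrite XE.
pose up := [set Z | X `<=` Z].
have up_fin : finite_set (P `&` up) by apply: sub_finite_set P_fin => Z [].
pose d : int := \sum_(Z \in [set Z | Q Z /\ le Z (pi X)]) mu Z.
have sumQ : \sum_(Z \in P `&` up `&` Q) mu Z = d.
  apply: eq_fsbigl; apply/seteqP; split=> [Z [[PZ XZ] QZ]|Z [QZ pXZ]].
    by split=> //; exact: pXmin.
  by split=> //; split; [exact: QP|exact: subset_trans XpX pXZ].
have sumNQ : \sum_(Z \in (P `\` Q) `&` up) mu (pi Z) *+ cover_count Z =
    d *+ cover_count X.
  rewrite (fibration_sum (mu \o pi)) mulr_cover_count [LHS]big_seq [RHS]big_seq.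
  apply: eq_bigr => a sa /=; case: asboolP => Xa; last first.
    by rewrite fsbig1 // => Z [_ /= XZa]; case: Xa; apply: subset_trans XZa _; exact: subIsetr.
  rewrite /d (_ : [set Y | Q Y /\ up (Y `&` a)] = [set Z | Q Z /\ le Z (pi X)]).
    apply: eq_fsbigr => Z; rewrite inE => -[QZ _]; congr mu.
    have [PZa _ _ Zmin] := cut QZ sa; have [QpZa ZapZa pZamin _ _] := piP _ PZa.
    apply/seteqP; split; last exact: Zmin.
    by apply: pZamin => //; exact: subIsetl.
  apply/seteqP; split=> Z [QZ].
    move=> XZa; split=> //; apply: pXmin => //; apply: subset_trans XZa _; exact: subIsetl.
  move=> pXZ; split=> //; rewrite /up /= subsetI; split=> //.
  exact: subset_trans XpX pXZ.
(* The sum d vanishes unless [pi X] is the whole torus; in that case X equals every graph containing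
   it, so there is exactly one. *)
have d_cover : d *+ cover_count X = d.
  have [pXE|pXbot] := pselect (pi X = bot); last first.
    by rewrite /d muQ_sum // mul0rn.
  suff -> : cover_count X = 1%N by rewrite mulr1n.
  have XE a : a \in s -> X `<=` a -> X = a.
    by move=> sa Xa; rewrite {1}(pXa a sa Xa) pXE; apply/setIidr; exact: s_torus.
  rewrite /cover_count (_ : count _ s = count_mem X s).
    by rewrite count_uniq_mem // (XE a0 sa0 Xa0) sa0.
  apply: eq_in_count => a sa /=; apply/asboolP/eqP => [/(XE _ sa) //|-> //].
have := mu_sum X PX X_bot.
rewrite (_ : [set Z | P Z /\ le Z X] = P `&` up) // (fsbigID Q) // sumQ.
rewrite (_ : P `&` up `&` ~` Q = (P `\` Q) `&` up); last by rewrite setIAC.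
have B_fin : finite_set ((P `\` Q) `&` up) by apply: sub_finite_set P_fin => Z [[]].
have BX : ((P `\` Q) `&` up) X by split=> //.
rewrite (fsbigD1 X) //=.
have := sumNQ; rewrite d_cover (fsbigD1 X) //= => <-.
rewrite (_ : \sum_(Z \in (P `\` Q) `&` up `\ X) mu Z =
   \sum_(Z \in (P `\` Q) `&` up `\ X) - (mu (pi Z) *+ cover_count Z)); last first.
  apply: eq_fsbigr => Z; rewrite inE => -[[[PZ nQZ] XZ] ZX].
  apply: IHn => //; rewrite ltnS in rX; apply: leq_trans rX.
  by apply: P_mono.
rewrite fsumrN ?addrA; first last.
  by apply: sub_finite_set B_fin => Z [].
set S' := \sum_(i \in _) _; set x := mu (pi X) *+ _ => H.
by apply/eqP; rewrite -addr_eq0; apply/eqP; rewrite -[RHS]H; ring.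
Qed.

Lemma codim_le X : (rank X <= l)%N.
Proof. by apply/bigmax_leqP => k _; rewrite -ltnS. Qed.

(** A cut by a graph raises the codimension by one and brings a factor -1, so each graph contributes
    minus the polynomial of Q divided by the variable. The factor ['X] avoids the division. *)
Lemma fibration_charpoly mu : is_moebius P le bot mu ->
  charpoly_from P l rank mu * 'X =
  charpoly_from Q l rank mu * ('X - (size s)%:Z%:P).
Proof.
move=> mu_moeb; have [pi piP] := fibration_projection.
have Q_fin : finite_set Q by exact: sub_finite_set QP P_fin.
have muE := moebius_fiber mu_moeb piP.
rewrite /charpoly_from (fsbigID Q) // (_ : P `&` Q = Q); last exact/setIidr.
rewrite mulrDl mulrBr; congr (_ + _).
rewrite (_ : P `&` ~` Q = (P `\` Q) `&` setT); last by rewrite setIT.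
rewrite (eq_fsbigr (fun X => - ((mu (pi X))%:P * 'X^(l - rank X)) *+ cover_count X)); last first.
  move=> X; rewrite inE => -[[PX nQX] _].
  by rewrite muE // polyCN polyCMn mulNr mulrnAl mulNrn.
rewrite (fibration_sum (fun X => - ((mu (pi X))%:P * 'X^(l - rank X)))).
rewrite mulr_suml (eq_big_seq (fun=> - \sum_(X \in Q) (mu X)%:P * 'X^(l - rank X))).
  rewrite big_const_seq iter_addr_0 count_predT mulNrn -mulr_natr; congr (- (_ * _)).
  by rewrite -natz polyC_natr.
move=> a sa; rewrite (_ : [set Y | Q Y /\ setT (Y `&` a)] = Q); last first.
  by apply/seteqP; split=> Y; [case|split].
rewrite mulr_fsuml -fsumrN //; apply: eq_fsbigr => Y; rewrite inE => QY.
have [PYa nQYa rYa Ymin] := cut QY sa; have [QpYa YapYa pYamin _ _] := piP _ PYa.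
have -> : pi (Y `&` a) = Y.
  apply/seteqP; split; last exact: Ymin.
  by apply: pYamin => //; exact: subIsetl.
(* Natural subtraction truncates, so [rank Y < l] is needed; it holds because the cut has rank one
   more and at most l. *)
rewrite mulNr -mulrA -exprSr rYa subnSK //.
by rewrite -rYa; exact: codim_le.
Qed.

End FibrationCharpoly.

(** * Ideals of type C *)

Section TypeCRoots.
Variable l : nat.
Implicit Types (b c e f : ivec l).

Local Notation eps := (eps l).

(** [root_ge b c] unfolds to [cone (b - c)]. *)
Definition cone c := exists k : nat -> nat, c = \sum_(1 <= m < l.+1) alpha l m *+ k m.

Lemma cone0 : cone 0.
Proof. by exists (fun=> 0%N); rewrite big1. Qed.

Lemma coneD b c : cone b -> cone c -> cone (b + c).
Proof.
move=> [k ->] [k' ->]; exists (fun m => k m + k' m)%N.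
by rewrite -big_split; apply: eq_bigr => m _; rewrite mulrnDr.
Qed.

Lemma cone_alpha m : (1 <= m <= l)%N -> cone (alpha l m).
Proof.
move=> m_l; exists (fun j => (j == m) : nat).
rewrite (bigD1_seq m) ?iota_uniq ?mem_index_iota ?ltnS //= eqxx mulr1n.
by rewrite big1 ?addr0 // => j /negPf ->.
Qed.

Lemma cone_epsB i j : (1 <= i)%N -> (i <= j <= l)%N -> cone (eps i - eps j).
Proof.
move=> i1; elim: j => [|j IHj] /andP[ij jl]; first by rewrite leqNgt i1 in ij.
have [->|neq_ij] := eqVneq i j.+1; first by rewrite subrr; exact: cone0.
have ij' : (i <= j)%N by rewrite -ltnS ltn_neqAle neq_ij.
rewrite -(subrKA (eps j)); apply: coneD; first by apply: IHj; rewrite ij' ltnW.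
have := @cone_alpha j; rewrite /alpha jl; apply.
by rewrite (leq_trans i1 ij') ltnW.
Qed.

(** 2 eps_j is twice eps_j - eps_l plus the last simple root 2 eps_l. *)
Lemma cone_eps2 j : (1 <= j <= l)%N -> cone (eps j *+ 2).
Proof.
move=> /andP[j1 jl]; have : cone (eps j - eps l) by apply: cone_epsB; rewrite ?jl ?leqnn.
move=> jlc; have := @cone_alpha l; rewrite /alpha ltnn leqnn andbT (leq_trans j1 jl).
move=> /(_ isT) lc; rewrite -[eps j](subrK (eps l)) mulrnDl.
by apply: coneD => //; rewrite mulr2n; exact: coneD.
Qed.

Variable I : set (ivec l).
Hypothesis idealI : is_ideal I.

Lemma ideal_le b c : I b -> pos_roots c -> cone (b - c) -> I c.
Proof. by case: idealI => _ down Ib pc [k bcE]; apply: (down b) => //; exists k. Qed.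

Lemma pos_eps2 i : (1 <= i <= l)%N -> pos_roots (eps i *+ 2).
Proof. by move=> /andP[i1 il]; left; exists i. Qed.

Lemma pos_epsB i j : (1 <= i)%N -> (i < j)%N -> (j <= l)%N -> pos_roots (eps i - eps j).
Proof. by move=> i1 ij jl; right; exists i, j; split=> //; left. Qed.

Lemma pos_epsD i j : (1 <= i)%N -> (1 <= j)%N -> i <> j -> (i <= l)%N -> (j <= l)%N ->
  pos_roots (eps i + eps j).
Proof.
move=> i1 j1 ij il jl; right.
have [lt_ij|lt_ji|//] := ltngtP i j.
  by exists i, j; split=> //; right.
by exists j, i; split=> //; right; rewrite addrC.
Qed.

Definition trunc_roots k : set (ivec l) :=
  [set b | I b /\ forall j : 'I_l, (j < k)%N -> b j = 0].

Lemma epsE i (j : 'I_l) : eps i j = (j.+1 == i)%:Z.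
Proof. by rewrite ffunE. Qed.

Lemma lead_rootP k e : (k < l)%N -> (trunc_roots k `\` trunc_roots k.+1) e <->
  I e /\ (e = eps k.+1 *+ 2 \/
     exists j, [/\ (k.+1 < j)%N, (j <= l)%N & e = eps k.+1 - eps j \/ e = eps k.+1 + eps j]).
Proof.
move=> kl; pose i := Ordinal kl; split.
  move=> [[Ie ek] nek]; split=> //.
  have ei : e i <> 0.
    move=> ei; apply: nek; split=> // j; rewrite ltnS leq_eqVlt => /orP[/eqP jk|/ek //].
    by rewrite (_ : j = i) //; exact: val_inj.
  have lt_k m (m1 : (1 <= m)%N) (ml : (m <= l)%N) :
      (forall j : 'I_l, j.+1 = m -> e j <> 0) -> (k < m)%N.
    move=> em; rewrite ltnNge; apply/negP => mk.
    have ml' : (m.-1 < l)%N by rewrite prednK.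
    by apply: (em (Ordinal ml')); rewrite /= ?prednK //; apply: ek; rewrite /= prednK.
  have [sub_pos _] := idealI; case: (sub_pos _ Ie) => [[m [m1 ml eE]]|[m [j [m1 mj jl eE]]]].
    have km : (k < m)%N.
      by apply: lt_k => // j jm; rewrite eE ffunMnE epsE jm eqxx.
    left; suff -> : k.+1 = m by [].
    by apply/eqP; apply/negPn/negP => /negPf mk; apply: ei; rewrite eE ffunMnE epsE mk.
  have km : (k < m)%N.
    apply: lt_k => // [|j' jm]; first by rewrite ltnW // (leq_trans mj).
    have /negPf mj' : m != j by rewrite ltn_eqF.
    by case: eE => ->; rewrite !ffunE jm eqxx mj'.
  right; exists j; suff -> : k.+1 = m by [].
  apply/eqP; apply/negPn/negP => /negPf mk; apply: ei.
  have /negPf kj : k.+1 != j by rewrite ltn_eqF // (leq_ltn_trans km).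
  by case: eE => ->; rewrite !ffunE /= mk kj.
move=> [Ie eE]; split.
  split=> // j jk; have /negPf jk1 : j.+1 != k.+1 by rewrite eqSS ltn_eqF.
  case: eE => [->|[m [km ml eE]]]; first by rewrite ffunMnE epsE jk1.
  have /negPf jm : j.+1 != m by rewrite ltn_eqF // (leq_trans _ km) // ltnS ltnW // ltnS.
  by case: eE => ->; rewrite !ffunE jk1 jm.
move=> [_ /(_ i (ltnSn _))].
case: eE => [->|[m [km ml eE]]]; first by rewrite ffunMnE epsE eqxx.
have /negPf jm : k.+1 != m by rewrite ltn_eqF.
by case: eE => ->; rewrite !ffunE /= eqxx jm.
Qed.

Lemma trunc_eps2 k j : (k < j)%N -> I (eps j *+ 2) -> trunc_roots k (eps j *+ 2).
Proof.
move=> kj Ij; split=> // i ik; rewrite ffunMnE epsE ltn_eqF //.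
by rewrite (leq_ltn_trans ik).
Qed.

Lemma trunc_epsD k j m : (k < j)%N -> (k < m)%N -> I (eps j + eps m) ->
  trunc_roots k (eps j + eps m).
Proof.
by move=> kj km Ijm; split=> // i ik; rewrite !ffunE !ltn_eqF // (leq_ltn_trans ik).
Qed.

Lemma trunc_epsB k j m : (k < j)%N -> (k < m)%N -> I (eps j - eps m) ->
  trunc_roots k (eps j - eps m).
Proof.
by move=> kj km Ijm; split=> // i ik; rewrite !ffunE !ltn_eqF // (leq_ltn_trans ik).
Qed.

Lemma trunc_sub k : trunc_roots k.+1 `<=` trunc_roots k.
Proof. by move=> b [Ib bk]; split=> // j jk; apply: bk; rewrite ltnS ltnW. Qed.

Lemma ideal_eps2 i j : (1 <= i)%N -> (i <= j)%N -> (j <= l)%N -> I (eps i *+ 2) -> I (eps j *+ 2).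
Proof.
move=> i1 ij jl Ii; apply: (ideal_le Ii); first by apply: pos_eps2; rewrite (leq_trans i1).
by rewrite -mulrnBl mulr2n; apply: coneD; apply: cone_epsB => //; rewrite ij.
Qed.

Lemma ideal_eps2B i j : (1 <= i)%N -> (i < j)%N -> (j <= l)%N -> I (eps i *+ 2) -> I (eps i - eps j).
Proof.
move=> i1 ij jl Ii; apply: (ideal_le Ii); first exact: pos_epsB.
rewrite (_ : _ - _ = eps i - eps j + eps j *+ 2).
  apply: coneD; first by apply: cone_epsB; rewrite // (ltnW ij).
  by apply: cone_eps2; rewrite jl (leq_trans i1 (ltnW ij)).
by apply/ffunP => m; rewrite !(ffunE, ffunMnE); ring.
Qed.

Lemma ideal_eps2D i j : (1 <= i)%N -> (i < j)%N -> (j <= l)%N -> I (eps i *+ 2) -> I (eps i + eps j).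
Proof.
move=> i1 ij jl Ii; apply: (ideal_le Ii).
  apply: pos_epsD => //; [exact: leq_trans (ltnW ij)|by move=> ijE; rewrite ijE ltnn in ij|exact: leq_trans (ltnW ij) jl].
rewrite (_ : _ - _ = eps i - eps j).
  by apply: cone_epsB; rewrite // (ltnW ij).
by apply/ffunP => m; rewrite !(ffunE, ffunMnE); ring.
Qed.

Definition lead_pair k e := exists j, [/\ (k.+1 < j)%N, (j <= l)%N &
  e = eps k.+1 - eps j \/ e = eps k.+1 + eps j].

(* If eps_k +- eps_j and eps_k +- eps_m lie in an ideal, their difference is up to
   sign eps_j - eps_m, eps_j + eps_m or 2 eps_j, and lies below one of them. *)
Lemma lead_pair_chord k e f : I e -> I f -> lead_pair k e -> lead_pair k f -> e <> f ->
  trunc_roots k.+1 (e - f) \/ trunc_roots k.+1 (f - e).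
Proof.
have mixed j m : (k.+1 < j)%N -> (j <= l)%N -> (k.+1 < m)%N -> (m <= l)%N ->
    I (eps k.+1 + eps m) -> trunc_roots k.+1 (eps k.+1 + eps m - (eps k.+1 - eps j)).
  move=> kj jl km ml Im.
  rewrite (_ : _ - _ = eps j + eps m); last by apply/ffunP => ?; rewrite !ffunE; ring.
  have coneB : cone (eps k.+1 - eps j) by apply: cone_epsB; rewrite // (ltnW kj).
  have [jm|jm] := eqVneq j m.
    rewrite -jm -mulr2n; apply: trunc_eps2 => //; apply: (ideal_le Im).
      by apply: pos_eps2; rewrite jl andbT (leq_trans _ kj).
    by rewrite -jm (_ : _ - _ = eps k.+1 - eps j) //; apply/ffunP => ?; rewrite !(ffunE, ffunMnE); ring.
  apply: trunc_epsD => //; apply: (ideal_le Im).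
    by apply: pos_epsD => //; [exact: leq_trans kj|exact: leq_trans km|exact/eqP].
  by rewrite (_ : _ - _ = eps k.+1 - eps j) //; apply/ffunP => ?; rewrite !ffunE; ring.
have minus j m : (k.+1 < j)%N -> (j < m)%N -> (m <= l)%N ->
    I (eps k.+1 - eps m) -> trunc_roots k.+1 (eps k.+1 - eps m - (eps k.+1 - eps j)).
  move=> kj jm ml Im.
  rewrite (_ : _ - _ = eps j - eps m); last by apply/ffunP => ?; rewrite !ffunE; ring.
  apply: trunc_epsB => //; first exact: ltn_trans jm.
  apply: (ideal_le Im); first by apply: pos_epsB => //; exact: leq_trans kj.
  rewrite (_ : _ - _ = eps k.+1 - eps j); last by apply/ffunP => ?; rewrite !ffunE; ring.
  by apply: cone_epsB => //; rewrite (ltnW kj) (leq_trans (ltnW jm) ml).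
have plus j m : (k.+1 < j)%N -> (j < m)%N -> (m <= l)%N ->
    I (eps k.+1 + eps m) -> trunc_roots k.+1 (eps k.+1 + eps j - (eps k.+1 + eps m)).
  move=> kj jm ml Im.
  rewrite (_ : _ - _ = eps j - eps m); last by apply/ffunP => ?; rewrite !ffunE; ring.
  apply: trunc_epsB => //; first exact: ltn_trans jm.
  apply: (ideal_le Im); first by apply: pos_epsB => //; exact: leq_trans kj.
  rewrite (_ : _ - _ = (eps k.+1 - eps j) + eps m *+ 2); last first.
    by apply/ffunP => ?; rewrite !(ffunE, ffunMnE); ring.
  apply: coneD; first by apply: cone_epsB => //; rewrite (ltnW kj) (leq_trans (ltnW jm) ml).
  by apply: cone_eps2; rewrite ml andbT (leq_trans _ jm).
move=> Ie If [j [kj jl eE]] [m [km ml fE]] ef.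
case: eE => eE; case: fE => fE; rewrite eE fE in Ie If ef *.
- have [jm|mj|jm] := ltngtP j m; [right|left|by rewrite jm in ef]; exact: minus.
- by right; exact: mixed.
- by left; exact: mixed.
- have [jm|mj|jm] := ltngtP j m; [left|right|by rewrite jm in ef]; exact: plus.
Qed.

Lemma lead_chord k e f : (k < l)%N ->
  (trunc_roots k `\` trunc_roots k.+1) e -> (trunc_roots k `\` trunc_roots k.+1) f ->
  e <> f ->
  exists b (p q : int), [/\ trunc_roots k.+1 b, q != 0 & b = e *~ p + f *~ q].
Proof.
move=> kl /(lead_rootP _ kl)[Ie eE] /(lead_rootP _ kl)[If fE] ef.
have two j : (k.+1 < j)%N -> (j <= l)%N -> I (eps k.+1 *+ 2) -> trunc_roots k.+1 (eps j *+ 2).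
  by move=> kj jl Ik; apply: trunc_eps2 => //; apply: ideal_eps2 Ik => //; exact: ltnW.
case: eE fE => [eE|eE] [fE|fE].
- by rewrite eE fE in ef.
(* Twice the pair cancels the leading term of [eps k.+1 *+ 2] and leaves plus or minus [eps j *+ 2],
   which lies below it in the root order and hence in I. *)
- have [j [kj jl fE']] := fE; exists (eps j *+ 2); rewrite eE in Ie.
  case: fE' => fE'; [exists 1, (- 2)|exists (- 1), 2]; split=> //; try exact: two;
    by rewrite eE fE'; apply/ffunP => m; rewrite !(ffunE, ffunMzE, ffunMnE); ring.
- have [j [kj jl eE']] := eE; exists (eps j *+ 2); rewrite fE in If.
  case: eE' => eE'; [exists (- 2), 1|exists 2, (- 1)]; split=> //; try exact: two;
    by rewrite fE eE'; apply/ffunP => m; rewrite !(ffunE, ffunMzE, ffunMnE); ring.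
- have [ef'|fe'] := lead_pair_chord Ie If eE fE ef.
    exists (e - f), 1, (- 1); split; [exact: ef'|by []|].
    by apply/ffunP => m; rewrite !(ffunE, ffunMzE); ring.
  exists (f - e), (- 1), 1; split; [exact: fe'|by []|].
  by apply/ffunP => m; rewrite !(ffunE, ffunMzE); ring.
Qed.

End TypeCRoots.

(** * Graphs over the remaining coordinates *)

Section Graphs.
Variables (R : realType) (l : nat) (i : 'I_l).
Implicit Types (z t : Point R l) (f : ivec l).

Definition graph f (w : R[i]) : set (Point R l) := [set t | torus t /\ character f t = w].

(** With coefficient 1 at i the level sets of f are connected, and they form the components of the
    hypertorus of [f *+ m]. *)
Lemma lay_graph z f m : torus z -> f i = 1 -> (0 < m)%N ->
  lay z [set f *+ m] = graph f (character f z).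
Proof.
move=> zT fi m0; apply/seteqP; split.
  move=> t zt; split; first exact: lay_torus zt.
  apply: (lay_character zT zt) => th oth; apply: (dotMn_eq0 m0); exact: oth.
move=> t [tT tf]; have [th tE] := rot_surj zT tT.
have fth : cis (dot f th) = 1 by apply/(character_rot_eq f th zT); rewrite -tE.
exists (th - dot f th *: delta_mx i ord0).
  by move=> _ ->; rewrite dotMn dot_retract // mulr0.
by rewrite (rot_retract _ i fth).
Qed.

Lemma graph_inj f f' w w' : f i = 1 -> f' i = 1 -> graph f w !=set0 ->
  graph f w = graph f' w' -> f = f' /\ w = w'.
Proof.
move=> fi f'i [z [zT zw]] ww'.
have [_ zw'] : graph f' w' z by rewrite -ww'.
suff ff' : f = f' by split; [exact: ff'|rewrite -zw -zw' ff'].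
have layE (c : ivec l) : c i = 1 -> lay z [set c] = graph c (character c z).
  by move=> ci; exact: (@lay_graph z c 1 zT ci isT).
have : lay z [set f] `<=` lay z [set f'].
  by rewrite (layE f fi) (layE f' f'i) zw zw' ww'.
move=> /(lay_sub_cl _ _ zT).2/(_ f' erefl) clf.
apply/ffunP => j; apply/eqP; rewrite -(@eqr_int R); apply/eqP.
(* This vector is orthogonal to f, and its pairing with f' is [f' j - f j]. *)
have := clf (delta_mx j ord0 - (f j)%:~R *: delta_mx i ord0).
rewrite dotDr dotNr dotZr !dot_delta f'i mulr1 => f'f; apply/esym/eqP.
rewrite -subr_eq0 f'f // => _ ->.
by rewrite dotDr dotNr dotZr !dot_delta fi mulr1 subrr.
Qed.

End Graphs.

Section LeadAtoms.
Variables (R : realType) (l : nat) (I : set (ivec l)).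
Hypothesis idealI : is_ideal I.

Local Notation eps := (eps l).

Lemma eps_inj j m : (1 <= j <= l)%N -> eps j = eps m -> j = m.
Proof.
move=> /andP[j1 jl] jm; have jl' : (j.-1 < l)%N by rewrite prednK.
have /ffunP/(_ (Ordinal jl')) := jm; rewrite !epsE /= prednK // eqxx.
by case: eqP.
Qed.

Lemma eps_neqN j m : (1 <= j <= l)%N -> eps j <> - eps m.
Proof.
move=> /andP[j1 jl] jm; have jl' : (j.-1 < l)%N by rewrite prednK.
have /ffunP/(_ (Ordinal jl')) := jm; rewrite !ffunE /= prednK // eqxx.
by case: eqP.
Qed.

Lemma eps_neq0 j : (1 <= j <= l)%N -> eps j <> 0.
Proof.
move=> /andP[j1 jl] j0; have jl' : (j.-1 < l)%N by rewrite prednK.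
by have /ffunP/(_ (Ordinal jl')) := j0; rewrite epsE ffunE /= prednK // eqxx.
Qed.

Variable k : nat.
Hypothesis kl : (k < l)%N.

Definition lead_pairs : seq (ivec l) :=
  [seq c <- [seq eps k.+1 - eps j | j <- iota k.+2 (l - k.+1)] ++
            [seq eps k.+1 + eps j | j <- iota k.+2 (l - k.+1)] | `[< I c >]].

(** A pair of c and w stands for [graph c w]. The hypertorus of [eps k.+1 *+ 2] has two components,
    recorded as the values 1 and -1 of the primitive character [eps k.+1]. *)
Definition lead_graphs : seq (ivec l * R[i]) :=
  [seq (c, 1) | c <- lead_pairs] ++
  (if `[< I (eps k.+1 *+ 2) >] then [:: (eps k.+1, 1); (eps k.+1, -1)] else [::]).

Definition lead_atoms := [seq graph p.1 p.2 | p <- lead_graphs].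

Definition lead_count : nat := (bcount I k.+1 + 2 * `[< I (eps k.+1 *+ 2) >])%N.

Lemma mem_iota_lead j : (j \in iota k.+2 (l - k.+1)) = (k.+1 < j)%N && (j <= l)%N.
Proof. by rewrite mem_iota addSn subnKC. Qed.

Lemma mem_lead_pairs c : c \in lead_pairs <-> I c /\ lead_pair k c.
Proof.
rewrite mem_filter mem_cat; split.
  move=> /andP[/asboolP Ic /orP[|] /mapP[j]]; rewrite mem_iota_lead => /andP[kj jl] cE;
    split=> //; exists j; split=> //; by [left|right].
move=> [Ic [j [kj jl cE]]]; apply/andP; split; first exact/asboolP.
by apply/orP; case: cE => ->; [left|right]; apply/mapP; exists j; rewrite // mem_iota_lead kj.
Qed.

Lemma lead_pair1 c : lead_pair k c -> c (Ordinal kl) = 1.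
Proof.
move=> [j [kj jl]]; have /negPf kj' : k.+1 != j by rewrite ltn_eqF.
by case=> ->; rewrite !ffunE /= eqxx kj'.
Qed.

Lemma lead_eps1 : eps k.+1 (Ordinal kl) = 1.
Proof. by rewrite epsE eqxx. Qed.

Lemma lead_graphs1 p : p \in lead_graphs -> p.1 (Ordinal kl) = 1.
Proof.
rewrite mem_cat => /orP[/mapP[c /mem_lead_pairs[_ cP] -> /=]|]; first exact: lead_pair1.
by case: asboolP => // _; rewrite !inE => /orP[|] /eqP -> /=; exact: lead_eps1.
Qed.

Lemma lead_graphs_neq0 p : p \in lead_graphs -> graph p.1 p.2 !=set0.
Proof.
have g1 c : @graph R l c 1 !=set0.
  by exists (tunit R l); split; [exact: torus_tunit|exact: character_tunit].
rewrite mem_cat => /orP[/mapP[c _ -> /=]|]; first exact: g1.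
case: asboolP => // _; rewrite !inE => /orP[|] /eqP -> /=; first exact: g1.
exists (rot (tunit R l) (pi *: delta_mx (Ordinal kl) ord0)).
split; first exact/torus_rot/torus_tunit.
rewrite character_rot ?character_tunit; last exact: torus_tunit.
rewrite dotZr dot_delta lead_eps1 mulr1 mul1r /cis cospi sinpi.
by apply/eqP; rewrite eq_complex /= oppr0 !eqxx.
Qed.

Lemma uniq_lead_graphs : uniq lead_graphs.
Proof.
have jP j : j \in iota k.+2 (l - k.+1) -> (1 <= j <= l)%N.
  by rewrite mem_iota_lead => /andP[kj ->]; rewrite (leq_trans _ kj).
have upairs : uniq lead_pairs.
  rewrite filter_uniq // cat_uniq !map_inj_in_uniq ?iota_uniq ?andbT /=.
  - apply/hasPn => _ /mapP[j /jP jl ->]; apply/mapP => -[m _] /addrI; exact: eps_neqN.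
  - by move=> j m /jP jl _ /addrI/(eps_inj jl).
  - by move=> j m /jP jl _ /addrI/oppr_inj/(eps_inj jl).
have eps_notin w : (eps k.+1, w) \notin [seq (c, 1 : R[i]) | c <- lead_pairs].
  apply/mapP => -[c /mem_lead_pairs[_ [j [kj jl cE]]] [cE' _]].
  have jl' : (1 <= j <= l)%N by rewrite jl andbT (leq_trans _ kj).
  apply: (eps_neq0 jl'); rewrite -cE' in cE; case: cE => cE.
    by rewrite -[LHS]opprK -[- eps j](addKr (eps k.+1)) -cE addNr oppr0.
  by rewrite -[LHS](addKr (eps k.+1)) -cE addNr.
rewrite cat_uniq map_inj_uniq ?upairs => [|c c' [] //].
case: asboolP => //= _; rewrite !negb_or !eps_notin /= !andbT.
apply/eqP => /(congr1 snd) /eqP; rewrite /= -subr_eq0 opprK => /eqP n1.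
by have := pnatr_eq0 (R[i]) 2; rewrite -[2%:R]/(1 + 1) n1 eqxx.
Qed.

Lemma lead_atoms_uniq : uniq lead_atoms.
Proof.
rewrite map_inj_in_uniq ?uniq_lead_graphs // => -[c w] [c' w'] cw cw' /= gE.
have [] := graph_inj (lead_graphs1 cw) (lead_graphs1 cw') (lead_graphs_neq0 cw) gE.
by move=> /= -> ->.
Qed.

Lemma size_lead_atoms : size lead_atoms = lead_count.
Proof.
rewrite size_map size_cat size_map /lead_count; congr addn; last by case: asboolP.
rewrite size_filter count_cat !count_map /bcount /index_iota subSS.
by rewrite big_split /=; congr addn; rewrite -sum1_count big_mkcond /=;
  apply: eq_bigr => j _; case: asboolP.
Qed.

Lemma lead_prim e : (trunc_roots I k `\` trunc_roots I k.+1) e ->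
  exists f m, [/\ (0 < m)%N, e = f *+ m & f (Ordinal kl) = 1].
Proof.
move=> /(lead_rootP idealI _ kl)[Ie [->|eP]].
  by exists (eps k.+1), 2%N; split=> //; exact: lead_eps1.
by exists e, 1%N; split=> //; exact: lead_pair1.
Qed.

Lemma lead_atomsP :
  @toric_arrangement R l (trunc_roots I k `\` trunc_roots I k.+1) = [set` lead_atoms].
Proof.
have lay1 (z : Point R l) (f : ivec l) w : torus z -> f (Ordinal kl) = 1 -> character f z = w ->
    lay z [set f] = graph f w.
  by move=> zT fi <-; exact: (@lay_graph R l (Ordinal kl) z f 1 zT fi isT).
have lay2 (z : Point R l) (f : ivec l) w : torus z -> f (Ordinal kl) = 1 -> character f z = w ->
    lay z [set f *+ 2] = graph f w.
  by move=> zT fi <-; exact: (@lay_graph R l (Ordinal kl) z f 2 zT fi isT).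
have sqr (z : Point R l) (f : ivec l) : torus z -> character (f *+ 2) z = character f z ^+ 2.
  by move=> zT; have [th zE] := character_torus zT; rewrite !zE dotMn expr2 -cisD mulr_natl mulr2n.
apply/seteqP; split=> a.
  move=> /arrangementP[z [e [zT /(lead_rootP idealI _ kl)[Ie eE] e1 ->]]] /=.
  case: eE => [eE|eP].
    rewrite eE in Ie e1 *; apply/mapP.
    have mem w : w = 1 \/ w = -1 -> (eps k.+1, w) \in lead_graphs.
      move=> w1; rewrite mem_cat; apply/orP; right; rewrite asboolT // !inE.
      by case: w1 => ->; rewrite eqxx // orbT.
    exists (eps k.+1, character (eps k.+1) z); last exact: (lay2 _ _ _ zT lead_eps1).
    apply: mem; move: e1; rewrite (sqr _ _ zT) => /eqP.
    by rewrite sqrf_eq1 => /orP[|] /eqP; [left|right].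
  apply/mapP; exists (e, 1); last exact: (lay1 _ _ _ zT (lead_pair1 eP) e1).
  by rewrite mem_cat map_f //; apply/mem_lead_pairs.
move=> /mapP[p pg ->]; have [z [zT zw]] := lead_graphs_neq0 pg.
have p1 := lead_graphs1 pg.
apply/arrangementP; exists z; move: pg; rewrite mem_cat => /orP[/mapP[c /mem_lead_pairs[Ic cP] pE]|].
  rewrite pE /= in zw p1 *; exists c; split.
  - exact: zT.
  - by apply/(lead_rootP idealI _ kl); split=> //; right.
  - exact: zw.
  - by rewrite (lay1 _ _ _ zT p1 zw).
case: asboolP => // I2 pP; have pE : p.1 = eps k.+1 /\ p.2 ^+ 2 = 1.
  by move: pP; rewrite !inE => /orP[|] /eqP ->; rewrite /= ?sqrrN expr1n.
have [p1E p2E] := pE; rewrite p1E in zw p1 *; exists (eps k.+1 *+ 2); split.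
- exact: zT.
- by apply/(lead_rootP idealI _ kl); split=> //; left.
- by rewrite (sqr _ _ zT) zw p2E.
- by rewrite (lay2 _ _ _ zT p1 zw).
Qed.

End LeadAtoms.

(** * The chain of truncated arrangements *)

Section Chain.
Variables (R : realType) (l : nat) (I : set (ivec l)).
Hypothesis idealI : is_ideal I.

Local Notation le := (@layer_le R l).
Local Notation rank := (@codim R l).
Local Notation bot := (@torus R l).
Local Notation L k := (layers (@toric_arrangement R l (trunc_roots I k))).
Local Notation d := (lead_count I).

Definition TM_chain (P : set (set (Point R l))) r (Qs : nat -> set (set (Point R l))) :=
  [/\ rank_is P rank r, Qs 0%N = [set bot], Qs r = P &
      forall i, (i < r)%N ->
        [/\ Qs i `<=` Qs i.+1, Qs i <> Qs i.+1,
            is_TM_ideal (Qs i.+1) le rank bot (Qs i) & rank_is (Qs i) rank i]].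

Lemma trunc_top : trunc_roots I l = set0.
Proof.
apply/seteqP; split=> // b [Ib b0].
have [/(_ b Ib) + _] := idealI; case=> [[i [i1 il bE]]|[i [j [i1 ij jl bE]]]].
  have il' : (i.-1 < l)%N by rewrite prednK.
  have := b0 (Ordinal il') il'; rewrite bE ffunMnE epsE /= prednK // eqxx.
  by [].
have il' : (i.-1 < l)%N by rewrite prednK // ltnW // (leq_trans ij).
have := b0 (Ordinal il') il'.
have /negPf nij : i != j by rewrite ltn_eqF.
by case: bE => ->; rewrite !ffunE /= prednK // eqxx nij.
Qed.

Lemma layers_top : L l = [set bot].
Proof.
rewrite trunc_top; apply/seteqP; split=> X; last first.
  by move=> ->; exact: layers_torus.
move=> /layersP[z [S [zT S0 _ ->]]]; apply/seteqP; split; first exact: lay_torus.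
move=> t tT; have [th ->] := rot_surj zT tT; exists th => //.
by move=> b /S0.
Qed.

Lemma lead_fibration k : (k < l)%N ->
  fibration (L k) (L k.+1) [set` lead_atoms R I k].
Proof.
move=> kl; rewrite -(lead_atomsP R idealI kl).
apply: (@layers_fibration R l _ _ (Ordinal kl)).
- exact: trunc_sub.
- by move=> b [_ /(_ (Ordinal kl) (ltnSn _))].
- by move=> e; exact: lead_prim.
- by move=> e f; exact: lead_chord.
Qed.

Lemma lead_atoms_torus k a : a \in lead_atoms R I k -> a `<=` bot.
Proof. by move=> /mapP[p _ ->] t []. Qed.

(** All characters are trivial at the unit point, so any root with leading coordinate k would
    produce an atom through it. *)
Lemma no_lead_atoms k : (k < l)%N -> d k = 0%N -> L k.+1 = L k.
Proof.
move=> kl d0; suff -> : trunc_roots I k.+1 = trunc_roots I k by [].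
apply/seteqP; split; first exact: trunc_sub.
move=> e ek; apply: contrapT => nek.
have : toric_arrangement (trunc_roots I k `\` trunc_roots I k.+1) (lay (tunit R l) [set e]).
  apply/arrangementP; exists (tunit R l), e.
  by split; [exact: torus_tunit|split|exact: character_tunit|].
rewrite lead_atomsP // /=.
by have /eqP := size_lead_atoms R I k; rewrite d0 size_eq0 => /eqP ->.
Qed.

(** Coordinates are released from the last to the first. The chain grows only when [d k] is
    positive, so r counts the nonzero exponents; purity is carried along because the TM-ideal
    property needs it. *)
Lemma lead_chain n : (n <= l)%N -> exists r Qs,
  [/\ r = count (fun i => 0 < d i)%N (iota (l - n) n), TM_chain (L (l - n)) r Qs,
      finite_set (L (l - n)) &
      forall x, is_maximal (L (l - n)) le x -> rank x = r].
Proof.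
elim: n => [|n IHn] nl.
  exists 0%N, (fun=> [set bot]); rewrite subn0 layers_top; split=> //.
  - split=> //; split; first by exists bot; split=> //; exact: codim_torus.
    by move=> x ->; rewrite codim_torus.
  - by move=> x [-> _]; exact: codim_torus.
have [r [Qs [rE [rk_r Qs0 Qsr chainQ] finQ pureQ]]] := IHn (ltnW nl).
set k := (l - n.+1)%N; have kl : (k < l)%N by rewrite /k -subSn // subSS leq_subr.
have kE : (l - n)%N = k.+1 by rewrite /k -subSn.
rewrite kE in rE rk_r Qsr finQ pureQ.
rewrite /= -rE; have [d0|d_gt0] := posnP (d k).
  rewrite add0n -(no_lead_atoms kl d0).
  by exists r, Qs; split.
have fib := lead_fibration kl.
have A0 : [set` lead_atoms R I k] !=set0.
  move: d_gt0; rewrite -(size_lead_atoms R).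
  by case: (lead_atoms R I k) => // a s _; exists a; rewrite /= inE eqxx.
have Atorus := @lead_atoms_torus k.
exists r.+1, (fun i => if (i <= r)%N then Qs i else L k); split=> //.
- split.
  + exact: (fibration_rank fib).
  + exact: Qs0.
  + by rewrite ltnn.
  move=> i; rewrite ltnS => ir; rewrite ir; have [lt_ir|] := ltnP i r; first exact: chainQ.
  move=> ri; have -> : i = r by apply/eqP; rewrite eqn_leq ir.
  rewrite Qsr; split.
  + by have [] := fib.
  + move=> QP; have [a Aa] := A0; have [_ Qbot /(_ _ _ Qbot Aa)[Pa nQa _ _] _] := fib.
    by rewrite QP in nQa.
  + exact: (fibration_TM_ideal fib Atorus A0 pureQ).
  + exact: rk_r.
- exact: (fibration_finite fib finQ).
- exact: (fibration_pure fib A0 pureQ).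
Qed.

Lemma lead_finite k : (k <= l)%N -> finite_set (L k).
Proof.
by move=> kl; have [r [Qs []]] := lead_chain (leq_subr k l); rewrite subKn.
Qed.

(** Each coordinate trades a factor ['X] on the left for a linear factor. Coordinates with [d k = 0]
    need no separate case: their fibration has an empty set of graphs. *)
Lemma lead_charpoly n mu : (n <= l)%N -> is_moebius (L (l - n)) le bot mu ->
  charpoly_from (L (l - n)) l rank mu * 'X^n =
  'X^l * \prod_(i <- iota (l - n) n) ('X - (d i)%:Z%:P).
Proof.
elim: n mu => [|n IHn] mu nl.
  rewrite subn0 layers_top big_nil !mulr1 => -[mu_bot _].
  by rewrite /charpoly_from fsbig_set1 mu_bot mul1r codim_torus subn0.
set k := (l - n.+1)%N; have kl : (k < l)%N by rewrite /k -subSn // subSS leq_subr.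
have kE : (l - n)%N = k.+1 by rewrite /k -subSn.
have fib := lead_fibration kl.
move=> mu_moeb; have := IHn mu (ltnW nl); rewrite kE => IH.
rewrite exprS mulrA (@fibration_charpoly R l _ (L k.+1) (lead_atoms R I k)) //.
- rewrite mulrAC IH; last by apply: (fibration_moebius fib) mu_moeb.
  by rewrite (size_lead_atoms R) /= big_cons -mulrA [_ * ('X - _)]mulrC.
- exact: lead_atoms_uniq.
- by move=> a; exact: lead_atoms_torus.
- by apply: lead_finite; exact: ltnW.
- exact: codim_ltn.
Qed.

Lemma trunc0 : trunc_roots I 0 = I.
Proof. by apply/seteqP; split=> [b []|b Ib] //; split. Qed.

End Chain.

(** * Comparison with the expected exponents *)

Section Exponents.
Variables (l : nat) (I : set (ivec l)).
Hypothesis idealI : is_ideal I.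

(** From s on, I contains every root with leading vector eps_i, so [bcount I i] is 2 (l - i), and
    the two components of 2 eps_i add 2. Between n and s there is no 2 eps_i in I; before n there is
    no root with leading vector eps_i at all. *)
Lemma expected_exponentsE : expected_exponents I = [seq lead_count I i | i <- iota 0 l].
Proof.
rewrite /expected_exponents; set s := s_index I; set n := n_index I.
have s_le : (s <= l.+1)%N.
  by rewrite /s /s_index ltnS (leq_trans (find_size _ _)) // size_iota.
have ns : (n <= s)%N by exact: geq_minl.
have n1 : (1 <= n)%N by rewrite /n /n_index leq_min.
have not2 i : (1 <= i)%N -> (i < s)%N -> ~ I (eps l i *+ 2).
  case: i => // i _; rewrite /s /s_index ltnS => i_lt.
  have il : (i < l)%N by rewrite (leq_trans i_lt) // (leq_trans (find_size _ _)) // size_iota.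
  by have /asboolP := before_find 0%N i_lt; rewrite nth_iota // add0n; case: asboolP.
have two i : (s <= i)%N -> (i <= l)%N -> I (eps l i *+ 2).
  move=> si il; have sl := leq_trans si il.
  have has_s : has (fun k => `[< I (eps l k.+1 *+ 2) >]) (iota 0 l).
    by rewrite has_find size_iota; exact: sl.
  have := nth_find 0%N has_s; rewrite nth_iota; last by rewrite -[l in (_ < l)%N](size_iota 0) -has_find.
  by rewrite add0n => /asboolP; apply: (ideal_eps2 idealI).
have E0 i : (1 <= i)%N -> (i < n)%N -> bcount I i = 0%N.
  case: i => // i _; rewrite /n /n_index leq_min => /andP[_]; rewrite ltnS => i_lt.
  have il : (i < l)%N by rewrite (leq_trans i_lt) // (leq_trans (find_size _ _)) // size_iota.
  have := before_find 0%N i_lt; rewrite nth_iota // add0n => /asboolP nE.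
  rewrite /bcount big_nat_cond big1 // => j /andP[/andP[ij jl] _].
  have nI b : (b = eps l i.+1 - eps l j \/ b = eps l i.+1 + eps l j) -> ~ I b.
    by move=> bE Ib; apply: nE; exists b; split=> //; exists j.
  by rewrite !asboolF //; apply: nI; [right|left].
have full i : (s <= i)%N -> (1 <= i)%N -> (i <= l)%N -> bcount I i = (2 * (l - i))%N.
  move=> si i1 il; have I2 := two i si il.
  rewrite /bcount big_nat_cond (eq_bigr (fun=> 2%N)).
    by rewrite -big_nat_cond sum_nat_const_nat subSS mulnC.
  move=> j /andP[/andP[ij jl] _].
  by rewrite !asboolT //; [apply: (ideal_eps2D idealI)|apply: (ideal_eps2B idealI)].
pose d0 i := (bcount I i + 2 * `[< I (eps l i *+ 2) >])%N.
have -> : [seq lead_count I i | i <- iota 0 l] = [seq d0 i | i <- iota 1 l].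
  by rewrite -[1%N]addn0 iotaDl -map_comp.
have -> : iota 1 l = iota 1 n.-1 ++ iota n (s - n) ++ iota s (l.+1 - s).
  have -> : l = (n.-1 + ((s - n) + (l.+1 - s)))%N.
    by rewrite addnBAC ?subnKC; lia.
  by rewrite !iotaD; congr (_ ++ (iota _ _ ++ iota _ _)); lia.
rewrite !map_cat; congr (_ ++ (_ ++ _)).
- suff /all_pred1P : all (pred1 0%N) [seq d0 i | i <- iota 1 n.-1].
    by rewrite size_map size_iota => ->.
  rewrite all_map; apply/allP => i; rewrite mem_iota add1n prednK // => /andP[i1 i_n].
  by rewrite /= /d0 E0 // asboolF //; apply: not2 => //; exact: leq_trans ns.
- apply/eq_in_map => i; rewrite mem_iota subnKC // => /andP[ni is_].
  by rewrite /d0 asboolF ?muln0 ?addn0 //; apply: not2 => //; exact: leq_trans ni.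
- apply/eq_in_map => i; rewrite mem_iota subnKC // ltnS => /andP[si il].
  have i1 : (1 <= i)%N by rewrite (leq_trans _ si) // (leq_trans n1).
  by rewrite /d0 asboolT ?full //; [rewrite muln1 mulnDr|exact: two].
Qed.

End Exponents.

Theorem theorem7p9 (R : realType) (l : nat) (I : set (ivec l)) :
  is_ideal I ->
  arrangement_strictly_supersolvable (@toric_arrangement R l I) /\
  has_exponents (@toric_arrangement R l I) (expected_exponents I).
Proof.
move=> idealI; have [r [Qs [rE chain finP _]]] := @lead_chain R l I idealI l (leqnn l).
rewrite subnn trunc0 in rE chain finP.
split.
  split; first exact: layers_locally_geometric.
  by exists r, Qs; exact: chain.
set u := [seq lead_count I i | i <- iota 0 l].
(* Some [bcount I i] with i between n and s can vanish, for instance when I consists of eps_1 -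
   eps_2 alone; the positive exponents are therefore obtained by filtering. *)
exists r, [seq x <- u | 0 < x]%N.
have [rk_r _ _ _] := chain.
have size_u : size u = l by rewrite size_map size_iota.
have count_u : count (fun x => 0 < x)%N u = r by rewrite rE count_map.
have count_nu : count (fun x => ~~ (0 < x)%N) u = (l - r)%N.
  by rewrite -size_u -(count_predC (fun x => 0 < x)%N u) count_u addKn.
split.
- exact: rk_r.
- by rewrite size_filter.
- exact: filter_all.
split.
- move=> mu mu_moeb.
  have := @lead_charpoly R l I idealI l mu (leqnn l); rewrite subnn trunc0 => /(_ mu_moeb).
  have Xn0 : 'X^l != 0 :> {poly int} by rewrite monic_neq0 ?monicXn.
  rewrite mulrC => /(mulfI Xn0) ->.
  rewrite -[LHS](big_map (lead_count I) xpredT (fun x : nat => 'X - (x%:Z)%:P)) -/u.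
  rewrite (bigID (fun x => 0 < x)%N) /= mulrC big_filter; congr (_ * _).
  rewrite (eq_bigr (fun=> 'X)) => [|x]; last by rewrite lt0n negbK => /eqP ->; rewrite subr0.
  by rewrite big_const_seq count_nu iter_mulr_1.
- rewrite expected_exponentsE // -/u.
  apply: (perm_trans (y := [seq x <- u | ~~ (0 < x)%N] ++ [seq x <- u | 0 < x]%N)).
    rewrite perm_cat2r -count_nu -size_filter.
    suff /all_pred1P <- : all (pred1 0%N) [seq x <- u | ~~ (0 < x)%N] by [].
    by apply/allP => x; rewrite mem_filter lt0n negbK => /andP[].
  by rewrite perm_catC perm_filterC.
Qed.
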